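(* Let $p$ be a prime and let $G$ be an abelian $p$-group. Then $G$ is semi-generalized co-Bassian if, and only if, the subgroup $pG$ is generalized co-Bassian, i.e., (equivalently) $pG$ has generalized finite $p$-rank.
   Context: All groups are abelian, written additively. A subgroup $H$ of a group $A$ is essential in $A$ if $H\cap S\neq\{0\}$ for every non-zero subgroup $S$ of $A$ (so $\{0\}$ is essential in $\{0\}$). A group $G$ is semi-generalized co-Bassian if, for every subgroup $H\leq G$ and every injective homomorphism $\varphi:G\to G/H$, the image $\varphi(G)$ is an essential subgroup of some direct summand of $G/H$. A group $G$ is generalized co-Bassian if, for every subgroup $H\leq G$ and every injective homomorphism $\varphi:G\to G/H$, the image $\varphi(G)$ is a direct summand of $G/H$. An abelian $p$-group $A$ has generalized finite $p$-rank if $A\cong \mathbb{Z}_{p^{\sigma_1}}^{(\rho_1)}\oplus\dots\oplus\mathbb{Z}_{p^{\sigma_n}}^{(\rho_n)}$, where $\sigma_1<\dots<\sigma_n$ is an increasing sequence of elements of $\omega\cup\{\infty\}$ and $\rho_1,\dots,\rho_n$ are cardinals with $\rho_j$ finite whenever $j>1$. Here $\mathbb{Z}_{p^k}$ is the cyclic group of order $p^k$, $\mathbb{Z}_{p^\infty}$ is the Prüfer (quasi-cyclic) $p$-group, and $A^{(\rho)}$ denotes the direct sum of $\rho$ copies of $A$. *)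

(* Defs.v *)
From HB Require Import structures.
From mathcomp Require Import all_boot all_order all_algebra ring_quotient.
From mathcomp Require Import finmap boolp classical_sets cardinality.
From mathcomp.multinomials Require Import monalg.

Set Implicit Arguments.
Unset Strict Implicit.
Unset Printing Implicit Defensive.

Import GRing.Theory.
Local Open Scope ring_scope.

(* Abelian groups are [zmodType]s.  A subgroup of V is an [H : zmodClosed V];
   since [asbool] turns every predicate into a boolean one, these are all the
   subgroups of V.  The quotient group V / H is [Quotient.quot H]. *)

Section Subgroup.
Variables (V : zmodType) (H : zmodClosed V).

Record subgroup : predArgType := Subgroup {
  subgroup_val :> V;
  _ : subgroup_val \in (H : {pred V}) }.

HB.instance Definition _ := [isSub for subgroup_val].
HB.instance Definition _ := [Choice of subgroup by <:].
HB.instance Definition _ := [SubChoice_isSubZmodule of subgroup by <:].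

End Subgroup.

Section Image.
Variables (V W : zmodType) (f : {additive V -> W}).

Definition img_pred : W -> bool := fun y => `[< exists x, f x = y >].

Lemma img_zmod_closed : zmod_closed img_pred.
Proof.
split; first by apply/asboolP; exists 0; rewrite raddf0.
move=> _ _ /asboolP[x <-] /asboolP[y <-].
by apply/asboolP; exists (x - y); rewrite raddfB.
Qed.

HB.instance Definition _ :=
  GRing.isZmodClosed.Build W img_pred img_zmod_closed.

Definition img : zmodClosed W := GRing.ZmodClosed.clone W img_pred _.

End Image.

Section Multiples.
Variables (V : zmodType) (n : nat).

Definition nmul (x : V) : V := x *+ n.

Lemma nmul_is_zmod_morphism : zmod_morphism nmul.
Proof. by move=> x y; rewrite /nmul mulrnBl. Qed.

HB.instance Definition _ :=
  GRing.isZmodMorphism.Build V V nmul nmul_is_zmod_morphism.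

(* The subgroup nV = {n x | x in V}, as a group in its own right. *)
Definition multiples : zmodType := subgroup (img nmul).

End Multiples.

Section Primary.
Variables (p : nat) (V : zmodType).

Definition primary_pred : V -> bool :=
  fun x => `[< exists k, x *+ p ^ k = 0 >].

Lemma primary_zmod_closed : zmod_closed primary_pred.
Proof.
split; first by apply/asboolP; exists 0%N; rewrite mul0rn.
move=> x y /asboolP[k xk] /asboolP[l yl]; apply/asboolP; exists (k + l)%N.
by rewrite mulrnBl expnD mulrnA xk mul0rn mulnC mulrnA yl mul0rn subrr.
Qed.

HB.instance Definition _ :=
  GRing.isZmodClosed.Build V primary_pred primary_zmod_closed.

Definition primary : zmodClosed V := GRing.ZmodClosed.clone V primary_pred _.

End Primary.

Definition abelian_pgroup (p : nat) (V : zmodType) : Prop :=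
  forall x : V, x \in primary p V.

Definition direct_summand (V : zmodType) (K : zmodClosed V) : Prop :=
  exists L : zmodClosed V,
    (forall x, x \in K -> x \in L -> x = 0) /\
    (forall x, exists a b, [/\ a \in K, b \in L & x = a + b]).

(* N is contained, and essential, in the subgroup K of V. *)
Definition essential_in (V : zmodType) (N K : zmodClosed V) : Prop :=
  {subset N <= K} /\
  forall S : zmodClosed V, {subset S <= K} ->
    (exists2 x, x \in S & x != 0) -> exists x, [/\ x \in N, x \in S & x != 0].

Definition generalized_co_Bassian (V : zmodType) : Prop :=
  forall (H : zmodClosed V) (phi : {additive V -> Quotient.quot H}),
    injective phi -> direct_summand (img phi).

Definition semi_generalized_co_Bassian (V : zmodType) : Prop :=
  forall (H : zmodClosed V) (phi : {additive V -> Quotient.quot H}),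
    injective phi ->
    exists2 K : zmodClosed (Quotient.quot H),
      direct_summand K & essential_in (img phi) K.

(* The Prüfer group: the p-primary component of Q/Z. *)
Definition prufer (p : nat) : zmodType :=
  subgroup (primary p (Quotient.quot (img (intr : {additive int -> rat})))).

(* An element of omega + {oo}: [Some k] is k and [None] is oo. *)
Definition exponent := option nat.

Definition exponent_lt (s t : exponent) : bool :=
  match s, t with
  | Some k, Some l => (k < l)%N
  | Some _, None => true
  | None, _ => false
  end.

(* ['I_n.+1] carries addition mod n.+1; [(p ^ k).-1.+1] is [p ^ k] for p > 0.
   ('Z_(p ^ k) would be wrong for k = 0, where it is Z/2.) *)
Definition Zp_exponent (p : nat) (s : exponent) : zmodType :=
  match s with
  | Some k => 'I_(p ^ k).-1.+1
  | None => prufer p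
  end.

Section FiniteDirectSum.
Variables (n : nat) (A : 'I_n -> zmodType).

Definition dirsum : Type := {dffun forall i : 'I_n, A i : choiceType}.

HB.instance Definition _ := Choice.on dirsum.

Definition dirsum_zero : dirsum := [ffun i => 0 : A i].
Definition dirsum_opp (f : dirsum) : dirsum := [ffun i => - f i : A i].
Definition dirsum_add (f g : dirsum) : dirsum := [ffun i => f i + g i : A i].

Lemma dirsum_addA : associative dirsum_add.
Proof. by move=> f g h; apply/ffunP => i; rewrite !ffunE addrA. Qed.

Lemma dirsum_addC : commutative dirsum_add.
Proof. by move=> f g; apply/ffunP => i; rewrite !ffunE addrC. Qed.

Lemma dirsum_add0 : left_id dirsum_zero dirsum_add.
Proof. by move=> f; apply/ffunP => i; rewrite !ffunE add0r. Qed.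

Lemma dirsum_addN : left_inverse dirsum_zero dirsum_opp dirsum_add.
Proof. by move=> f; apply/ffunP => i; rewrite !ffunE addNr. Qed.

HB.instance Definition _ := GRing.isZmodule.Build dirsum
  dirsum_addA dirsum_addC dirsum_add0 dirsum_addN.

End FiniteDirectSum.

(* [{malg B[I]}], the finitely supported functions from I to B, is the direct
   sum of I copies of B; the cardinals are given by the index types [rho j].
   Indices start at 0: all cardinals but the first one are finite. *)
Definition generalized_finite_prank (p : nat) (V : zmodType) : Prop :=
  exists (n : nat) (sigma : 'I_n -> exponent) (rho : 'I_n -> choiceType),
    [/\ forall i j : 'I_n, (i < j)%N -> exponent_lt (sigma i) (sigma j),
        forall j : 'I_n, (0 < j)%N -> finite_set [set: rho j]
      & exists f : {additive V ->
                     dirsum (fun j => {malg (Zp_exponent p (sigma j))[rho j]})},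
          bijective f].

(* Main.v *)
(* All three conditions on pG are equivalent to a dichotomy: for every m, either
   p^m A contains the socle A[p], or p^m A has finite socle (A = pG).

   Sufficiency.  If p^m A has finite socle, counting shows that an injective
   phi : A -> A / H maps p^m A onto p^m (A / H).  With the dichotomy, heights of socle
   elements do not grow under phi.  A subgroup whose socle elements keep their height is
   a direct summand as soon as some p^N A is divisible (Zorn).  In the semi-generalized
   case G = P + C with P[p] in pP = pG and C elementary; phi(P) keeps heights, and it is
   enlarged to a summand K with K[p] = phi(G)[p], which contains phi(G).

   Necessity.  If x in A[p] is not in p^(k+1) A although p^(k+1) A has infinite socle,
   there are enough independent elements of large order to build H and an injective
   phi : A -> A / H with phi(x) in p^(k+1) (A / H).

   Generalized finite p-rank.  Bases of the socle adapted to the heights lift to a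
   decomposition into cyclic and quasi-cyclic groups. *)

Require Import Defs.
From HB Require Import structures.
From mathcomp Require Import all_boot all_order all_algebra.
From mathcomp Require Import generic_quotient ring_quotient finmap boolp classical_sets cardinality.
From mathcomp.multinomials Require Import monalg.

Set Implicit Arguments.
Unset Strict Implicit.
Unset Printing Implicit Defensive.

Import GRing.Theory Num.Theory.
Local Open Scope ring_scope.

(** * Subgroups *)

(** An essential embedding controls socles only, and this shapes the converse. If [phi x] gains
    height, [phi G] itself cannot be a summand; but a summand [K] that merely has the socle of
    [phi G] may contain a root of [phi x] outside [phi G]. The embedding is therefore built so that,
    among the elements killed by [p ^ k.+1], those that become divisible by [p] lie in [pA] up to
    multiples of [x]; for [x] in [pA] of least height this turns a root in [K] into a root of [x].

    The quotient of the span [W] of the [w i] must contain a copy of [W], with [x] placed at large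
    height, and maps into it must extend from [W] to [A]. Sums of Prüfer groups do this if every
    [p ^ j A] has infinite socle. Otherwise infinitely many independent elements exist only up to
    order [p ^ n.+1], for the last level [n] with infinite socle; cyclic groups of that order are
    injective only among groups killed by [p ^ n.+1], which is why the maps into them vanish on
    [p ^ n.+1 A] and independence is taken modulo it. *)

Definition subgrp (V : zmodType) (P : V -> Prop) : Prop :=
  P 0 /\ forall x y, P x -> P y -> P (x - y).

Section SubgroupOfProp.
Variables (V : zmodType) (P : V -> Prop) (subP : subgrp P).

Definition zmod_of_pred : V -> bool := fun x => `[< P x >].

Lemma zmod_of_zmod_closed : zmod_closed zmod_of_pred.
Proof.
case: subP => P0 PB; split; first exact/asboolP.
by move=> x y /asboolP Px /asboolP Py; apply/asboolP/PB.
Qed.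

HB.instance Definition _ :=
  GRing.isZmodClosed.Build V zmod_of_pred zmod_of_zmod_closed.

Definition zmod_of : zmodClosed V := GRing.ZmodClosed.clone V zmod_of_pred _.

Lemma zmod_ofP x : (x \in zmod_of) <-> P x.
Proof. by rewrite unfold_in; split => [/asboolP|?]; last apply/asboolP. Qed.

End SubgroupOfProp.

Section SubgroupTheory.
Variables (V : zmodType).
Implicit Types (P Q : V -> Prop) (x y : V).

Lemma subgrp_zmodClosed (H : zmodClosed V) : subgrp (fun x => x \in H).
Proof. by split=> [|x y]; [exact: rpred0|exact: rpredB]. Qed.

Lemma subgrpN P x : subgrp P -> P x -> P (- x).
Proof. by move=> [P0 PB] Px; rewrite -sub0r; apply: PB. Qed.

Lemma subgrpD P x y : subgrp P -> P x -> P y -> P (x + y).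
Proof.
move=> sP Px Py; rewrite -[y]opprK.
by apply: (proj2 sP) => //; apply: subgrpN.
Qed.

Lemma subgrpMn P x n : subgrp P -> P x -> P (x *+ n).
Proof.
move=> sP Px; elim: n => [|n IHn]; first by rewrite mulr0n; case: sP.
by rewrite mulrS; apply: subgrpD.
Qed.

Lemma subgrpMz P x c : subgrp P -> P x -> P (x *~ c).
Proof.
move=> sP Px; case: c => n; first exact: subgrpMn.
by rewrite NegzE mulrNz; apply: subgrpN => //; apply: subgrpMn.
Qed.

Lemma subgrp_sum P (I : Type) (r : seq I) (F : I -> V) :
  subgrp P -> (forall i, P (F i)) -> P (\sum_(i <- r) F i).
Proof.
move=> sP PF; elim: r => [|i r IHr]; first by rewrite big_nil; case: sP.
by rewrite big_cons; apply: subgrpD.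
Qed.

Lemma subgrp0 : subgrp (fun x : V => x = 0).
Proof. by split=> // x y -> ->; rewrite subrr. Qed.

Definition sumgrp P Q x : Prop := exists a b, [/\ P a, Q b & x = a + b].

Lemma subgrp_add P Q : subgrp P -> subgrp Q -> subgrp (sumgrp P Q).
Proof.
move=> sP sQ; split.
  by exists 0, 0; rewrite addr0; split=> //; [case: sP|case: sQ].
move=> _ _ [a [b [Pa Qb ->]]] [c [d [Pc Qd ->]]].
exists (a - c), (b - d); split; [by apply: (proj2 sP)|by apply: (proj2 sQ)|].
by rewrite opprD addrACA.
Qed.

Lemma subgrp_addl P Q x : subgrp Q -> P x -> sumgrp P Q x.
Proof. by move=> [Q0 _] Px; exists x, 0; rewrite addr0. Qed.

Lemma subgrp_addr P Q x : subgrp P -> Q x -> sumgrp P Q x.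
Proof. by move=> [P0 _] Qx; exists 0, x; rewrite add0r. Qed.

Lemma subgrp_cyclic x : subgrp (fun y => exists c, y = x *~ c).
Proof.
split; first by exists 0; rewrite mulr0z.
by move=> _ _ [c ->] [d ->]; exists (c - d); rewrite mulrzBr.
Qed.

Lemma max_subgroup (Phi : (V -> Prop) -> Prop) (P0 : V -> Prop) :
  subgrp P0 -> Phi P0 ->
  (forall F : (V -> Prop) -> Prop,
     (exists P, F P) -> (forall P, F P -> Phi P) ->
     (forall P Q, F P -> F Q -> (forall x, P x -> Q x) \/ (forall x, Q x -> P x)) ->
     Phi (fun x => exists2 P, F P & P x)) ->
  exists P, [/\ subgrp P, forall x, P0 x -> P x, Phi P &
    forall Q, subgrp Q -> (forall x, P x -> Q x) -> Phi Q ->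
      forall x, Q x -> P x].
Proof.
move=> sP0 PhiP0 PhiU.
pose good (P : set V) := [/\ subgrp P, forall x, P0 x -> P x & Phi P].
(* [Zorn_bigcup] also covers the empty chain, whose union is the empty predicate and no subgroup.
   [T] admits it for that reason; comparison with [P0] excludes it afterwards. *)
pose T : set (set V) := fun P => (forall x, ~ P x) \/ good P.
have [] := @Zorn_bigcup V T.
  move=> F FT Ftot.
  have [[P FP goodP]|noF] := pselect (exists2 P, F P & good P); last first.
    left=> x [P FP Px].
    by case: (FT _ FP) => [/(_ x)|gP] //; case: noF; exists P.
  right; pose F' P := F P /\ good P.
  have -> : (\bigcup_(X in F) X)%classic = (fun x => exists2 P, F' P & P x).
    apply/seteqP; split=> [x [Q FQ Qx]|x [Q [FQ _] Qx]]; last by exists Q.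
    by exists Q => //; split=> //; case: (FT _ FQ) => // /(_ x).
  have F'tot P1 Q1 : F' P1 -> F' Q1 ->
      (forall x, P1 x -> Q1 x) \/ (forall x, Q1 x -> P1 x).
    by move=> [FP1 _] [FQ1 _]; exact: Ftot.
  split; last 1 first.
  - apply: PhiU => //; [by exists P|by move=> Q [_ []]].
  - split; first by exists P => //; case: goodP => -[].
    move=> x y [P1 F1 P1x] [P2 F2 P2y].
    case: (F'tot _ _ F1 F2) => [P12|P21].
      exists P2 => //; case: F2 => _ [s2 _ _].
      by apply: (proj2 s2) => //; apply: P12.
    exists P1 => //; case: F1 => _ [s1 _ _].
    by apply: (proj2 s1) => //; apply: P21.
  - by move=> x P0x; exists P => //; case: goodP => _ + _; apply.
move=> P [TP maxP].
have goodP : good P.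
  case: TP => // PE; case: (maxP P0); last by right; split.
  split=> [x /PE //|/(_ 0)]; case: sP0 => P00 _ /(_ P00); exact: PE.
exists P; case: goodP => sP P0P PhiP; split=> // Q sQ PQ PhiQ x Qx.
apply: contrapT => nPx; case: (maxP Q).
  by split=> // /(_ x Qx).
by right; split=> // y P0y; apply/PQ/P0P.
Qed.

End SubgroupTheory.

(** * Multiples and socles in p-groups *)

Section IntegerMultiples.
Variables (p : nat) (p_prime : prime p).

Lemma mulrn_pow (V : zmodType) (x : V) m n : x *+ p ^ (m + n) = x *+ p ^ m *+ p ^ n.
Proof. by rewrite expnD mulrnA. Qed.

Lemma mulrn_powS (V : zmodType) (x : V) n : x *+ p ^ n.+1 = x *+ p *+ p ^ n.
Proof. by rewrite expnS mulrnA. Qed.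

Lemma mulrn_powSr (V : zmodType) (x : V) n : x *+ p ^ n.+1 = x *+ p ^ n *+ p.
Proof. by rewrite expnSr mulrnA. Qed.

Lemma mulrn_pow0 (V : zmodType) (x : V) m n : (m <= n)%N -> x *+ p ^ m = 0 -> x *+ p ^ n = 0.
Proof. by move=> /subnKC <- x0; rewrite mulrn_pow x0 mul0rn. Qed.

Lemma mulrz_bezout (V : zmodType) (x : V) (c : int) k :
  ~ (p %| c)%Z -> x *+ p ^ k = 0 -> exists d, x = x *~ c *~ d.
Proof.
move=> pc xk.
have : coprimez c (p ^ k)%N.
  rewrite coprimezE absz_nat coprimeXr // coprime_sym prime_coprime //.
  by apply/negP; rewrite -[p]absz_nat -dvdzE.
case/coprimezP=> -[u v] /= uv; exists u.
rewrite -mulrzA mulrC -[LHS]mulr1z -uv mulrzDr [v * _]mulrC.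
by rewrite (mulrzA _ (p ^ k)%N) -pmulrn xk mul0rz addr0.
Qed.

Lemma mulrz_dvd (V : zmodType) (x : V) (c : int) : x *+ p = 0 -> (p %| c)%Z -> x *~ c = 0.
Proof.
move=> xp /dvdzP[d ->]; rewrite mulrC mulrzA.
by rewrite -pmulrn xp mul0rz.
Qed.

Lemma mulrz_socle_eq0 (V : zmodType) (x : V) (c : int) :
  x *+ p = 0 -> x != 0 -> x *~ c = 0 -> (p %| c)%Z.
Proof.
move=> xp x0 xc; apply: contrapT => pc.
have [d xd] := @mulrz_bezout _ x c 1 pc xp.
by move: x0; rewrite xd xc mul0rz eqxx.
Qed.

Lemma mulrnzC (V : zmodType) (x : V) n (c : int) : x *+ n *~ c = x *~ c *+ n.
Proof. by rewrite !pmulrn mulrzAC. Qed.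

Lemma mulrz_tower_eq0 (V : zmodType) (t v : V) (c : int) e :
  t *+ p = 0 -> t != 0 -> v *+ p ^ e = t -> v *~ c = 0 -> ((p ^ e.+1)%N %| c)%Z.
Proof.
move=> tp t0; elim: e v c => [|e IHe] v c vt vc.
  by apply: (mulrz_socle_eq0 tp t0); rewrite -vt mulrnzC vc mul0rn.
have /dvdzP[d cE] : ((p ^ e.+1)%N %| c)%Z.
  by apply: (IHe (v *+ p)); rewrite -?mulrn_powS // mulrnzC vc mul0rn.
have /dvdzP[d' dE] : (p %| d)%Z.
  apply: (mulrz_socle_eq0 tp t0); rewrite -vt -vc cE mulrC mulrzA.
  by rewrite -pmulrn.
by apply/dvdzP; exists d'; rewrite cE dE -mulrA -PoszM -expnS.
Qed.

(** A nonzero element of a p-group has a nonzero multiple in the socle; injectivity and trivial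
    intersections are tested there. *)
Lemma socle_trivial (V : zmodType) (L : V -> Prop) : abelian_pgroup p V ->
  subgrp L -> (forall x, L x -> x *+ p = 0 -> x = 0) -> forall x, L x -> x = 0.
Proof.
move=> pV sL L0 x; have /asboolP[k] := pV x.
elim: k x => [|k IHk] x xk Lx; first by rewrite -[x]mulr1n.
by apply: L0 => //; apply: IHk; rewrite -?mulrn_powS //; apply: subgrpMn.
Qed.

End IntegerMultiples.

(* The socle (p^j V)[p] of the subgroup p^j V. *)
Definition psoc (p : nat) (V : zmodType) (j : nat) (x : V) : Prop :=
  x *+ p = 0 /\ exists y, x = y *+ p ^ j.

Lemma psoc_le p (V : zmodType) i j (x : V) : (i <= j)%N -> psoc p j x -> psoc p i x.
Proof.
move=> ij [xp [y xy]]; split=> //; exists (y *+ p ^ (j - i)).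
by rewrite -mulrn_pow subnK.
Qed.

Lemma subgrp_psoc p (V : zmodType) j : subgrp (@psoc p V j).
Proof.
split; first by split; [rewrite mul0rn|exists 0; rewrite mul0rn].
move=> x y [xp [x' xE]] [yp [y' yE]]; split; first by rewrite mulrnBl xp yp subrr.
by exists (x' - y'); rewrite mulrnBl -xE -yE.
Qed.

(** * Extension of homomorphisms on p-groups *)

Lemma pairMz (V W : zmodType) (x : V) (y : W) (c : int) : (x, y) *~ c = (x *~ c, y *~ c).
Proof. by case: c => n; rewrite ?NegzE ?mulrNz -?pmulrn pairMnE. Qed.

Lemma graph_additive (A E : zmodType) (G : A * E -> Prop) : subgrp G ->
  (forall e, G (0, e) -> e = 0) -> (forall a, exists e, G (a, e)) ->
  exists f : {additive A -> E}, forall a e, G (a, e) -> f a = e.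
Proof.
move=> sG fG Gtot; have [f fP] := choice Gtot.
have fE a e : G (a, e) -> f a = e.
  move=> Ge; apply/eqP; rewrite -subr_eq0; apply/eqP/fG.
  by rewrite -[X in (X, _)](subrr a); apply: (proj2 sG _ _ (fP a) Ge).
have fB : zmod_morphism f.
  by move=> a b; apply: fE; apply: (proj2 sG _ _ (fP a) (fP b)).
by exists (HB.pack_for {additive A -> E} f (GRing.isZmodMorphism.Build _ _ f fB)).
Qed.

(* Partial homomorphisms from A to E are represented by their graphs. *)
Lemma baer_extension (p : nat) (p_prime : prime p) (A E : zmodType) (G0 : A * E -> Prop) :
  abelian_pgroup p A -> subgrp G0 -> (forall e, G0 (0, e) -> e = 0) ->
  (forall G, subgrp G -> (forall u, G0 u -> G u) -> (forall e, G (0, e) -> e = 0) ->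
     forall a e, G (a *+ p, e) -> exists e', e = e' *+ p) ->
  exists f : {additive A -> E}, forall a e, G0 (a, e) -> f a = e.
Proof.
move=> pA sG0 fG0 ext.
have [|G [sG G0G fG maxG]] := @max_subgroup _ (fun G : A * E -> Prop =>
    forall e, G (0, e) -> e = 0) G0 sG0 fG0.
  by move=> F _ FP _ e [P /FP]; apply.
have Gtot : forall a, exists e, G (a, e).
  move=> a; have /asboolP[k] := pA a; elim: k a => [|k IHk] a ak.
    by exists 0; rewrite mulr1n in ak; rewrite ak; case: sG.
  have [|e Ge] := IHk (a *+ p); first by rewrite -mulrn_powS.
  have [e' eE] := ext _ sG G0G fG _ _ Ge.
  have [[e'' Ge'']|nG] := pselect (exists e'', G (a, e'')); first by exists e''.
  (* Adjoining [(a, e')] keeps the graph single-valued: if [p] divides [c], then [a *~ c] already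
     has its value, and any other [c] with [a *~ c] in the domain would put [a] itself there. *)
  exists e'.
  pose C u := exists c : int, u = (a, e') *~ c.
  apply: (maxG _ (subgrp_add sG (subgrp_cyclic (a, e')))).
  - by move=> u Gu; apply: subgrp_addl => //; exact: subgrp_cyclic.
  - move=> x [u [_ [Gu [c ->] xE]]].
    have [/dvdzP[d cE]|/negP pc] := boolP (p %| c)%Z.
      apply: fG; rewrite xE; apply: subgrpD => //.
      rewrite cE mulrC mulrzA; apply: subgrpMz => //.
      by rewrite -pmulrn pairMnE -eE.
    case: nG; have [d aE] := mulrz_bezout p_prime pc ak.
    case: u Gu xE => u1 u2 Gu; rewrite pairMz => -[/esym/eqP].
    rewrite addrC addr_eq0 => /eqP acE _.
    exists (- (u2 *~ d)); rewrite aE acE mulNrz.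
    rewrite (_ : (_, _) = - ((u1, u2) *~ d)); last by rewrite pairMz.
    by apply: subgrpN => //; apply: subgrpMz.
  - by apply: subgrp_addr => //; exists 1; rewrite mulr1z.
have [f fE] := graph_additive sG fG Gtot.
by exists f => a e /G0G; apply: fE.
Qed.

(** * Socle-pure subgroups *)

(* p^N V is divisible *)
Definition divisible_from (p : nat) (V : zmodType) (N : nat) : Prop :=
  forall y : V, exists y', y *+ p ^ N = y' *+ p ^ N.+1.

(** For subgroups of a p-group this is the classical socle test for purity. *)
Definition socle_pure (p : nat) (V : zmodType) (K : V -> Prop) : Prop :=
  forall x j, K x -> psoc p j x -> exists2 y, K y & x = y *+ p ^ j.

Section Pure.
Variables (p : nat) (p_prime : prime p) (V : zmodType).
Implicit Types (x y t : V).

(** Stationary steps are allowed so that cyclic groups, where the tower stops, and quasi-cyclic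
    groups, where it does not, are treated alike. *)
Lemma subgrp_tower (v : nat -> V) : (forall l, v l = v l.+1 \/ v l = v l.+1 *+ p) ->
  subgrp (fun x => exists l c, x = v l *~ c).
Proof.
move=> vS.
have vle l d : exists c, v l = v (l + d)%N *~ c.
  elim: d => [|d [c ->]]; first by exists 1; rewrite addn0.
  rewrite addnS; case: (vS (l + d)%N) => ->; first by exists c.
  by exists (p%:Z * c); rewrite mulrzA -pmulrn.
split; first by exists 0, 0; rewrite mulr0z.
move=> _ _ [l [c ->]] [l' [c' ->]]; exists (l + l')%N.
have [d ->] := vle l l'; have [d' ->] := vle l' l; rewrite [(l' + l)%N]addnC.
by exists (d * c - d' * c'); rewrite mulrzBr !mulrzA.
Qed.

Lemma tower_socle t (v : nat -> V) : t *+ p = 0 -> t != 0 -> v 0 = t ->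
  (forall l, v l = v l.+1 \/ v l = v l.+1 *+ p) ->
  forall l c, v l *~ c *+ p = 0 -> exists d, v l *~ c = t *~ d.
Proof.
move=> tp t0 v0 vS l c vcp.
have [e te] : exists e, v l *+ p ^ e = t.
  elim: l {vcp} => [|l [e te]]; first by exists 0; rewrite v0.
  by case: (vS l) => vE; [exists e|exists e.+1]; rewrite -te vE // mulrn_powS.
have : ((p ^ e.+1)%N %| c * p)%Z.
  by apply: (mulrz_tower_eq0 p_prime tp t0 te); rewrite mulrzA -pmulrn.
rewrite expnSr PoszM dvdz_mul2r ?dvdzP; last by rewrite -lt0n prime_gt0.
by case/dvdzP=> d ->; exists d; rewrite mulrC mulrzA -pmulrn te.
Qed.

Lemma divisible_tower N y : divisible_from p V N ->
  exists v : nat -> V, v 0 = y *+ p ^ N /\ forall l, v l = v l.+1 *+ p.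
Proof.
move=> divN; have /choice[g gP] := divN.
exists (fun l => iter l g y *+ p ^ N); split=> // l.
by rewrite [LHS]gP mulrn_powSr.
Qed.

Lemma socle_tower N h t : divisible_from p V N -> psoc p h t -> t != 0 ->
  exists Q : V -> Prop, [/\ subgrp Q, Q t,
      forall q, Q q -> q *+ p = 0 -> exists c, q = t *~ c
    & forall j, (j <= h)%N \/ (N <= h)%N -> exists2 q, Q q & t = q *+ p ^ j].
Proof.
move=> divN [tp [y tE]] t0.
suff [v [v0 vS vh]] : exists v : nat -> V, [/\ v 0 = t,
    forall l, v l = v l.+1 \/ v l = v l.+1 *+ p &
    forall j, (j <= h)%N \/ (N <= h)%N -> t = v j *+ p ^ j].
  exists (fun x => exists l c, x = v l *~ c); split.
  - exact: subgrp_tower.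
  - by exists 0, 1; rewrite v0.
  - by move=> _ [l [c ->]]; apply: tower_socle.
  - by move=> j /vh tv; exists (v j) => //; exists j, 1.
have [Nh|hN] := leqP N h.
  have [v [v0 vS]] := divisible_tower (y *+ p ^ (h - N)) divN.
  have vt : v 0 = t by rewrite v0 tE -mulrn_pow subnK.
  exists v; split=> // [l|j _]; first by right.
  by rewrite -vt; elim: j => // j {1}->; rewrite vS mulrn_powS.
(* Truncated subtraction makes the tower stationary at [y] from [l = h] on. *)
exists (fun l => y *+ p ^ (h - l)); split=> [|l|j [jh|//]]; first by rewrite subn0.
  have [hl|lh] := leqP h l.
    by left; have /eqP -> := hl; have /eqP -> := leqW hl.
  by right; rewrite subnS -mulrn_powSr prednK // subn_gt0.
by rewrite -mulrn_pow subnK.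
Qed.

Lemma socle_pure_full (K : V -> Prop) : abelian_pgroup p V -> subgrp K ->
  socle_pure p K -> (forall x, x *+ p = 0 -> K x) -> forall x, K x.
Proof.
move=> pV sK pureK socK x; have /asboolP[k] := pV x.
elim: k x => [|k IHk] x xk.
  by rewrite mulr1n in xk; rewrite xk; case: sK.
have xkp : x *+ p ^ k *+ p = 0 by rewrite -mulrn_powSr.
have [|y Ky xE] := pureK (x *+ p ^ k) k (socK _ xkp); first by split=> //; exists x.
rewrite -(subrK y x); apply: subgrpD => //.
by apply: IHk; rewrite mulrnBl -xE subrr.
Qed.

(* Zorn's lemma; a maximal C is enlarged by a cyclic or quasi-cyclic group
   over an element of S \ (K + C) that has maximal height. *)
Lemma socle_pure_extension N (K S : V -> Prop) : abelian_pgroup p V ->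
  divisible_from p V N -> subgrp K -> socle_pure p K ->
  subgrp S -> (forall x, S x -> x *+ p = 0) -> (forall x, K x -> x *+ p = 0 -> S x) ->
  exists C : V -> Prop, [/\ subgrp C, forall x, K x -> C x -> x = 0,
    socle_pure p (sumgrp K C) &
    forall x, S x <-> sumgrp K C x /\ x *+ p = 0].
Proof.
move=> pV divN sK pureK sS Sp KS.
pose Phi (C : V -> Prop) := [/\ forall x, K x -> C x -> x = 0,
  forall a b, K a -> C b -> (a + b) *+ p = 0 -> S (a + b) &
  forall a b j, K a -> C b -> psoc p j (a + b) ->
    exists a' b', [/\ K a', C b' & a + b = (a' + b') *+ p ^ j]].
have s0 := subgrp0 V.
have [||C [sC _ [KC KCS pureKC] maxC]] := @max_subgroup V Phi _ s0.
- split=> [x _ ->//|a b Ka -> |a b j Ka ->]; rewrite addr0; first exact: KS.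
  by case/(pureK _ _ Ka) => y Ky ->; exists y, 0; rewrite addr0.
- move=> F _ FP _; split=> [x Kx [C /FP[KC _ _] Cx]|a b Ka [C /FP[_ KCS _] Cb]|].
  + exact: KC.
  + exact: KCS.
  + move=> a b j Ka [C FC Cb]; case: (FP _ FC) => _ _ h abj.
    by have [a' [b' [? ? ?]]] := h a b j Ka Cb abj; exists a', b'; split=> //; exists C.
have sKC := subgrp_add sK sC.
exists C; split=> //.
  move=> _ j [a [b [Ka Cb ->]]] abj.
  have [a' [b' [Ka' Cb' ->]]] := pureKC a b j Ka Cb abj.
  by exists (a' + b') => //; exists a', b'.
move=> x; split=> [Sx|[[a [b [Ka Cb ->]]]]]; last exact: KCS.
split; last exact: Sp.
pose T t := S t /\ ~ sumgrp K C t.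
apply: contrapT => nx.
(* Heights are compared only up to [N], from where on they are infinite; the cap makes a maximal [h]
   exist. *)
pose good j := `[< (j <= N)%N /\ exists2 t, T t & psoc p j t >].
have good0 : exists j, good j.
  exists 0; apply/asboolP; split=> //; exists x => //.
  by split; [exact: Sp|exists x].
have goodN j : good j -> (j <= N)%N by move=> /asboolP[].
case: (ex_maxnP good0 goodN) => h /asboolP[hN [t [St nt] th]] maxh.
have t0 : t != 0 by apply: contra_notN nt => /eqP ->; case: sKC.
have [Q [sQ Qt Qp Qh]] := socle_tower divN th t0.
have QKC q : Q q -> sumgrp K C q -> q = 0.
  move=> Qq KCq.
  have sL : subgrp (fun x => Q x /\ sumgrp K C x).
    by split=> [|y z [Qy Ky] [Qz Kz]]; split;
      solve [by case: sQ|by case: sKC|by apply: (proj2 sQ)|by apply: (proj2 sKC)].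
  apply: (socle_trivial pV sL) => // y [Qy KCy] yp.
  have [c yE] := Qp y Qy yp.
  have [pc|/negP pc] := boolP (p %| c)%Z; first by rewrite yE (mulrz_dvd th.1).
  case: nt; have [d ->] := @mulrz_bezout _ p_prime _ t c 1 pc th.1.
  by apply: subgrpMz => //; rewrite -yE.
have split_soc a b q : K a -> C b -> Q q -> (a + b + q) *+ p = 0 ->
    (a + b) *+ p = 0 /\ q *+ p = 0.
  move=> Ka Cb Qq; rewrite mulrnDl => /eqP.
  rewrite addr_eq0 => /eqP abE.
  have q0 : q *+ p = 0.
    apply: QKC; first exact: subgrpMn.
    rewrite -[_ *+ p]opprK -abE; apply: subgrpN => //; apply: subgrpMn => //.
    by exists a, b.
  by rewrite abE q0 oppr0.
case: nt; apply: subgrp_addr => //.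
apply: (maxC _ (subgrp_add sC sQ)); last exact: subgrp_addr.
  by move=> y Cy; apply: subgrp_addl.
split.
- move=> y Ky [b [q [Cb Qq yE]]].
  have q0 : q = 0.
    apply: QKC => //; exists y, (- b); split=> //; first exact: subgrpN.
    by rewrite yE addrC addKr.
  by apply: KC => //; rewrite yE q0 addr0.
- move=> a _ Ka [b [q [Cb Qq ->]]]; rewrite addrA => /(split_soc _ _ _ Ka Cb Qq)[abp qp].
  apply: subgrpD => //; first exact: KCS.
  by have [c ->] := Qp q Qq qp; apply: subgrpMz.
- move=> a _ j Ka [b [q [Cb Qq ->]]]; rewrite addrA => -[abqp [y yE]].
  have [abp qp] := split_soc _ _ _ Ka Cb Qq abqp.
  have [c qE] := Qp q Qq qp.
  have [pc|/negP pc] := boolP (p %| c)%Z.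
    rewrite qE (mulrz_dvd th.1) // addr0 in yE *.
    have [|a' [b' [Ka' Cb' ->]]] := pureKC a b j Ka Cb; first by split=> //; exists y.
    by exists a', b'; split=> //; apply: subgrp_addl.
  (* With [c] prime to [p] the element [a + b + q] lies in [T], so by maximality of [h] a power
     [p ^ j] that divides it also divides [t] inside [Q]; subtracting leaves [a + b] divisible by
     [p ^ j]. *)
  have Tabq : T (a + b + q).
    split; first by apply: subgrpD; [|exact: KCS|rewrite qE; exact: subgrpMz].
    move=> KCabq; apply: pc; apply: (mulrz_socle_eq0 p_prime th.1 t0).
    rewrite -qE; apply: QKC => //; rewrite -[q](addKr (a + b)).
    by rewrite addrC; apply: (proj2 sKC) => //; exists a, b.
  have [|q' Qq' tE] := Qh j.
    have [jN|/ltnW Nj] := leqP j N; [left|right]; apply: maxh; apply/asboolP;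
      split=> //; exists (a + b + q) => //; last apply: (psoc_le Nj);
      by split=> //; exists y.
  have [|a' [b' [Ka' Cb' abE]]] := pureKC a b j Ka Cb.
    split=> //; exists (y - q' *~ c); rewrite mulrnBl -yE -mulrnzC -tE -qE.
    by rewrite addrK.
  exists a', (b' + q' *~ c); split=> //.
    by exists b', (q' *~ c); split=> //; apply: subgrpMz.
  by rewrite addrA mulrnDl -abE qE tE mulrnzC.
Qed.

End Pure.

(** * Quotients of groups of finite rank *)

Section QuotientGroup.
Variables (V : zmodType) (H : zmodClosed V).
Local Notation X := (Quotient.quot H).

Definition qproj (x : V) : X := \pi_X%qT x.

Lemma qproj_is_zmod_morphism : zmod_morphism qproj.
Proof. exact: raddfB. Qed.

HB.instance Definition _ := GRing.isZmodMorphism.Build V X qproj qproj_is_zmod_morphism.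

Lemma qprojMn n : {morph qproj : x / x *+ n}.
Proof. exact: raddfMn. Qed.

Lemma qprojD : {morph qproj : x y / x + y}.
Proof. exact: raddfD. Qed.

Lemma qproj_surj (u : X) : exists x, u = qproj x.
Proof. by exists (repr u); rewrite /qproj /= reprK. Qed.

Lemma qproj_eq0 x : qproj x = 0 <-> x \in H.
Proof.
have <- : qproj 0 = 0 := raddf0 _.
by rewrite -[x]subr0 Quotient.idealrBE subr0; split=> [/eqP|/eqP].
Qed.

Lemma qproj_eq x y : qproj x = qproj y <-> x - y \in H.
Proof.
rewrite -qproj_eq0 qproj_is_zmod_morphism; split=> [->|/eqP]; first by rewrite subrr.
by rewrite subr_eq0 => /eqP.
Qed.

Lemma pgroup_quot p : abelian_pgroup p V -> abelian_pgroup p X.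
Proof.
move=> pV u; have [x ->] := qproj_surj u; have /asboolP[k xk] := pV x.
by apply/asboolP; exists k; rewrite -qprojMn xk raddf0.
Qed.

Lemma divisible_from_quot p N : divisible_from p V N -> divisible_from p X N.
Proof.
move=> divN u; have [x ->] := qproj_surj u; have [y xE] := divN x.
by exists (qproj y); rewrite -!qprojMn xE.
Qed.

End QuotientGroup.

Section FiniteRank.
Variables (p : nat) (A : zmodType).

Lemma finite_torsion j n : finite_set (@psoc p A j) ->
  finite_set [set x : A | (exists y, x = y *+ p ^ j) /\ x *+ p ^ n = 0]%classic.
Proof.
move=> finj; elim: n => [|n IHn].
  apply: (@sub_finite_set _ _ [set 0]%classic); last exact: finite_set1.
  by move=> x [_]; rewrite mulr1n.
set M := fun n => [set x : A | (exists y, x = y *+ p ^ j) /\ x *+ p ^ n = 0]%classic.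
have /choice[s sP] t : exists x, forall x', M n.+1 x' -> x' *+ p ^ n = t ->
    M n.+1 x /\ x *+ p ^ n = t.
  have [[x [Mx xt]]|nx] := pselect (exists x, M n.+1 x /\ x *+ p ^ n = t).
    by exists x.
  by exists 0 => x' Mx' xt'; case: nx; exists x'.
apply: (sub_finite_set _ (finite_image2 (fun t u => s t + u) finj IHn)).
move=> x Mx; have [[[y sE] _] sp] := sP _ x Mx erefl.
case: Mx => -[z xE] xp.
exists (x *+ p ^ n).
  split; first by rewrite -mulrn_powSr.
  by exists (z *+ p ^ n); rewrite xE -!mulrnA mulnC.
exists (x - s (x *+ p ^ n)); last by rewrite addrC subrK.
split; last by rewrite mulrnBl sp subrr.
by exists (z - y); rewrite mulrnBl -xE -sE.
Qed.

(* If u is not in the image of M[p^n], M = p^j A, then lifts of u and of that image,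
   translated by the finite group M[p^N] cap H, give too many elements of
   {m in M[p^N] | p^n m in H}, which is at most |M[p^n]| times as large as M[p^N] cap H. *)
Lemma quotient_power_image (H : zmodClosed A) (phi : {additive A -> Quotient.quot H}) j :
  abelian_pgroup p A -> injective phi -> finite_set (@psoc p A j) ->
  forall u, exists a, u *+ p ^ j = phi (a *+ p ^ j).
Proof.
move=> pA phi_inj finj u; have [b ->] := qproj_surj u; rewrite -qprojMn.
pose M n := [set x : A | (exists y, x = y *+ p ^ j) /\ x *+ p ^ n = 0]%classic.
have sM n : subgrp (M n).
  split; first by split; [exists 0; rewrite mul0rn|rewrite mul0rn].
  move=> x y [[x' xE] xn] [[y' yE] yn]; split; last by rewrite mulrnBl xn yn subrr.
  by exists (x' - y'); rewrite mulrnBl -xE -yE.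
have leM n n' x : (n <= n')%N -> M n x -> M n' x.
  by move=> nn' [? xn]; split=> //; exact: mulrn_pow0 nn' xn.
have /asboolP[n bn] := pA (b *+ p ^ j).
apply: contrapT => nb.
have /finite_seqP[r0 rE0] := finite_torsion n finj.
pose r := undup r0.
have rP x : (x \in r) <-> M n x.
  by rewrite mem_undup; have := congr1 (@^~ x) rE0; rewrite /M /= => ->.
have /choice[g gP] u' : exists l, forall v, u' = v *+ p ^ j ->
    (exists y, l = y *+ p ^ j) /\ qproj H l = u'.
  have [[v ->]|nv] := pselect (exists v, u' = v *+ p ^ j); last first.
    by exists 0 => v uv; case: nv; exists v.
  have [c ->] := qproj_surj v; exists (c *+ p ^ j) => _ _.
  by split; [exists c|rewrite qprojMn].
pose T := qproj H (b *+ p ^ j) :: map phi r.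
have uT : uniq T.
  rewrite /= map_inj_uniq // undup_uniq andbT.
  by apply/mapP => -[m /rP[[y mE] _] bE]; apply: nb; exists y; rewrite bE mE.
have TP v : v \in T -> [/\ exists y, g v = y *+ p ^ j, qproj H (g v) = v & v *+ p ^ n = 0].
  rewrite inE => /orP[/eqP ->|/mapP[m /rP[[y mE] mn] ->]].
    have [|? ?] := gP (qproj H (b *+ p ^ j)) (qproj H b); first by rewrite qprojMn.
    by split; rewrite // -qprojMn bn raddf0.
  have [|? ?] := gP (phi m) (phi y); first by rewrite mE raddfMn.
  by split; rewrite // -raddfMn mn raddf0.
have [N [nN gN]] : exists N, (n <= N)%N /\ forall v, v \in T -> M N (g v).
  have [N gN] : exists N, forall v, v \in T -> g v *+ p ^ N = 0.
    elim: {uT TP} T => [|v T' [N IHT]]; first by exists 0.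
    have /asboolP[k vk] := pA (g v); exists (N + k)%N => w; rewrite inE.
    case/orP=> [/eqP ->|/IHT wN]; first exact: mulrn_pow0 (leq_addl _ _) vk.
    exact: mulrn_pow0 (leq_addr _ _) wN.
  exists (n + N)%N; split=> [|v vT]; first exact: leq_addr.
  by split; [case: (TP v vT)|exact: mulrn_pow0 (leq_addl _ _) (gN v vT)].
have /finite_seqP[k0 kE0] : finite_set [set x | M N x /\ x \in H]%classic.
  apply: sub_finite_set (finite_torsion N finj) => x [] //.
pose K := undup k0.
have KP x : (x \in K) <-> M N x /\ x \in H.
  by rewrite mem_undup; have := congr1 (@^~ x) kE0; rewrite /= => ->.
have /choice[s sP] k : exists x, forall x', M N x' -> x' *+ p ^ n = k ->
    M N x /\ x *+ p ^ n = k.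
  have [[x [Mx xk]]|nx] := pselect (exists x, M N x /\ x *+ p ^ n = k).
    by exists x.
  by exists 0 => x' Mx' xk; case: nx; exists x'.
pose m v k := g v + k.
pose h v k := (m v k *+ p ^ n, m v k - s (m v k *+ p ^ n)).
have mM v k : v \in T -> k \in K -> M N (m v k).
  by move=> vT /KP[Mk _]; apply: subgrpD => //; apply: gN.
have piM v k : v \in T -> k \in K -> qproj H (m v k) = v.
  move=> vT /KP[_ /qproj_eq0 k0']; rewrite qprojD k0' addr0.
  by case: (TP v vT).
have hin v k : v \in T -> k \in K -> h v k \in [seq (x, y) | x <- K, y <- r].
  move=> vT kK; have Mm := mM v k vT kK.
  have [Ms sE] := sP _ _ Mm erefl.
  apply/allpairsP; exists (h v k); split=> //=.
    apply/KP; split; first exact: subgrpMn.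
    by apply/qproj_eq0; rewrite qprojMn piM //; case: (TP v vT).
  apply/rP; split; last by rewrite mulrnBl sE subrr.
  by have [] := proj2 (sM N) _ _ Mm Ms.
have : (size [seq h v k | v <- T, k <- K] <= size [seq (x, y) | x <- K, y <- r])%N.
  apply: uniq_leq_size; last first.
    by move=> _ /allpairsP[[v k] /= [vT kK ->]]; apply: hin.
  apply: allpairs_uniq => //; first exact: undup_uniq.
  move=> x y xTK yTK.
  have [[v k] /= [vT kK ->]] := elimT allpairsP xTK.
  have [[v' k'] /= [vT' kK' ->]] := elimT allpairsP yTK.
  rewrite /uncurry /= => -[e1 e2].
  have e : m v k = m v' k'.
    by move: e2; rewrite e1 => /addIr.
  have ev : v = v' by rewrite -(piM v k) // -(piM v' k') // e.
  by move: e; rewrite /m ev => /addrI ->.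
(* [T] has one element more than [r], so cancelling leaves [size K <= 0], although [0] lies in
   [K]. *)
rewrite !size_allpairs /= size_map mulSn [(size K * _)%N]mulnC.
rewrite -[leqRHS]add0n leq_add2r leqn0 => /nilP K0.
by have : 0 \in K; [apply/KP; split; [case: (sM N)|exact: rpred0]|rewrite K0].
Qed.

(** By induction on the exponent of [y *+ p ^ N]: its last nonzero multiple has a root [z] of the
    right depth, and subtracting [z *+ p] from [y] lowers the exponent. *)
Lemma divisible_from_psoc N : abelian_pgroup p A ->
  (forall x j, psoc p N x -> exists y : A, x = y *+ p ^ j) -> divisible_from p A N.
Proof.
move=> pA infht y; have /asboolP[k yk] := pA y.
have {yk} : y *+ p ^ N *+ p ^ k = 0 by rewrite -mulrn_pow addnC mulrn_pow yk mul0rn.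
elim: k y => [|k IHk] y yk; first by exists 0; rewrite mulr1n in yk; rewrite yk mul0rn.
have [|z zE] := infht (y *+ p ^ N *+ p ^ k) (N.+1 + k)%N.
  split; first by rewrite -mulrn_powSr.
  by exists (y *+ p ^ k); rewrite -!mulrnA mulnC.
have [|y' y'E] := IHk (y - z *+ p).
  by rewrite !mulrnBl zE addSn mulrn_powS mulrn_pow subrr.
by exists (y' + z); rewrite mulrnDl -y'E mulrnBl -mulrn_powS subrK.
Qed.

Lemma finite_psoc_divisible_from m : abelian_pgroup p A ->
  finite_set (@psoc p A m) -> exists N, (m <= N)%N /\ divisible_from p A N.
Proof.
move=> pA /finite_seqP[r rE].
(* The finite heights among finitely many socle elements are bounded; what remains above the bound
   has infinite height. *)
have [N mN rN] : exists2 N, (m <= N)%N &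
    forall t, t \in r -> (exists y, t = y *+ p ^ N) -> forall j, exists y, t = y *+ p ^ j.
  elim: r {rE} => [|t r [N mN IHr]]; first by exists m.
  have [infht|] := pselect (forall j, exists y, t = y *+ p ^ j).
    by exists N => // u; rewrite inE => /orP[/eqP -> //|/IHr].
  move=> /existsNP[j nj]; exists (N + j)%N; first exact: leq_trans mN (leq_addr _ _).
  move=> u; rewrite inE => /orP[/eqP ->|/IHr ur] [y uE].
    by case: nj; exists (y *+ p ^ N); rewrite -mulrn_pow.
  by apply: ur; exists (y *+ p ^ j); rewrite -mulrn_pow addnC.
exists N; split=> //; apply: divisible_from_psoc => // x j xN.
apply: rN; last by case: xN.
by have := psoc_le mN xN; rewrite rE.
Qed.

End FiniteRank.

(** * Sufficiency of the dichotomy *)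

Definition prank_dichotomy (p : nat) (A : zmodType) : Prop := forall m,
  (forall x : A, x *+ p = 0 -> exists y, x = y *+ p ^ m) \/ finite_set (@psoc p A m).

(* prank_dichotomy of the subgroup pG, expressed in G *)
Definition multiples_dichotomy (p : nat) (G : zmodType) : Prop := forall m,
  (forall x : G, psoc p 1 x -> exists y, x = y *+ p ^ m.+1) \/
  finite_set (@psoc p G m.+1).

Section Summands.
Variables (p : nat) (p_prime : prime p).

Lemma socle_pure_summand (X : zmodType) N (K : X -> Prop) (sK : subgrp K) :
  abelian_pgroup p X -> divisible_from p X N -> socle_pure p K ->
  direct_summand (zmod_of sK).
Proof.
move=> pX divN pureK.
have sS : subgrp (fun x : X => x *+ p = 0).
  by split=> [|x y xp yp]; rewrite ?mul0rn // mulrnBl xp yp subrr.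
have [||C [sC KC pureKC KCS]] := socle_pure_extension p_prime pX divN sK pureK sS => //.
exists (zmod_of sC); split=> [x /zmod_ofP Kx /zmod_ofP Cx|x]; first exact: KC.
have [|a [b [Ka Cb ->]]] := socle_pure_full pX (subgrp_add sK sC) pureKC _ x.
  by move=> y /KCS[].
by exists a, b; split=> //; apply/zmod_ofP.
Qed.

Lemma subgrp_image (A X : zmodType) (phi : {additive A -> X}) (P : A -> Prop) :
  subgrp P -> subgrp (fun u => exists2 a, P a & u = phi a).
Proof.
move=> sP; split; first by exists 0; [case: sP|rewrite raddf0].
by move=> _ _ [a Pa ->] [b Pb ->]; exists (a - b); [apply: (proj2 sP)|rewrite raddfB].
Qed.

Section Image.
Variables (A : zmodType) (pA : abelian_pgroup p A) (H : zmodClosed A).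
Variables (phi : {additive A -> Quotient.quot H}) (phi_inj : injective phi).

(** A root of [phi x] is found in [phi P] for one of two reasons: [P] already contains a root of
    [x], or by counting every [p ^ j]-multiple in the quotient comes from [p ^ j A = p ^ j P]. *)
Lemma socle_pure_image (P : A -> Prop) :
  (forall j, (forall x, P x -> x *+ p = 0 -> exists2 y, P y & x = y *+ p ^ j) \/
     (finite_set (@psoc p A j) /\ forall a, exists2 y, P y & a *+ p ^ j = y *+ p ^ j)) ->
  socle_pure p (fun u => exists2 a, P a & u = phi a).
Proof.
move=> htP _ j [x Px ->] [xp [u uE]].
case: (htP j) => [socP|[finj PA]].
  have [|y Py xE] := socP x Px; first by apply: phi_inj; rewrite raddfMn xp raddf0.
  by exists (phi y); [exists y|rewrite -raddfMn -xE].
have [a aE] := quotient_power_image pA phi_inj finj u.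
have [y Py yE] := PA a.
by exists (phi y); [exists y|rewrite uE aE yE raddfMn].
Qed.

End Image.

Lemma prank_dichotomy_divisible A : abelian_pgroup p A -> prank_dichotomy p A ->
  exists N, divisible_from p A N.
Proof.
move=> pA dichA; have [[m finm]|inf] := pselect (exists m, finite_set (@psoc p A m)).
  by have [N [_ divN]] := finite_psoc_divisible_from pA finm; exists N.
exists 0; apply: divisible_from_psoc => // x j [xp _].
by case: (dichA j) => [|finj]; [apply|case: inf; exists j].
Qed.

Lemma multiples_dichotomy_divisible A : abelian_pgroup p A -> multiples_dichotomy p A ->
  exists N, divisible_from p A N.
Proof.
move=> pA dichA; have [[m finm]|inf] := pselect (exists m, finite_set (@psoc p A m.+1)).
  by have [N [_ divN]] := finite_psoc_divisible_from pA finm; exists N.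
exists 1; apply: divisible_from_psoc => // x j x1.
case: (dichA j) => [/(_ x x1)[y ->]|finj]; last by case: inf; exists j.
by exists (y *+ p); rewrite mulrn_powS.
Qed.

Theorem prank_dichotomy_co_Bassian A : abelian_pgroup p A -> prank_dichotomy p A ->
  generalized_co_Bassian A.
Proof.
move=> pA dichA H phi phi_inj.
have [N divN] := prank_dichotomy_divisible pA dichA.
have sT : subgrp (fun _ : A => True) by [].
have pureY := @socle_pure_image A pA H phi phi_inj (fun=> True).
have [|L [dis tot]] := @socle_pure_summand _ N _ (subgrp_image phi sT) (pgroup_quot pA)
  (divisible_from_quot divN) (pureY _).
  move=> j; case: (dichA j) => [socA|finj]; [left|right].
    by move=> x _ /socA[y ->]; exists y.
  by split=> // a; exists a.
have imE u : u \in img phi <-> u \in zmod_of (subgrp_image phi sT).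
  rewrite zmod_ofP unfold_in; split=> [/asboolP[a <-]|[a _ ->]]; first by exists a.
  by apply/asboolP; exists a.
exists L; split=> [u /imE|u]; first exact: dis.
by have [a [b [? ? ->]]] := tot u; exists a, b; split=> //; apply/imE.
Qed.

(* G = P + C with C elementary and P[p] contained in pP = pG. *)
Lemma elementary_decomposition (G : zmodType) : abelian_pgroup p G ->
  exists P : G -> Prop, [/\ subgrp P,
    forall x, P x -> x *+ p = 0 -> (exists y, x = y *+ p)
    & forall a, exists2 x, P x & (a - x) *+ p = 0].
Proof.
move=> pG.
have maxdis (L0 N0 : G -> Prop) : subgrp L0 -> (forall x, L0 x -> N0 x -> x = 0) ->
    exists L, [/\ subgrp L, forall x, L0 x -> L x, forall x, L x -> N0 x -> x = 0 &
      forall x, (forall a c, L a -> N0 (a + x *~ c) -> a + x *~ c = 0) -> L x].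
  move=> sL0 dis0.
  have [|L [sL L0L LN maxL]] :=
    @max_subgroup _ (fun L : G -> Prop => forall x, L x -> N0 x -> x = 0) L0 sL0 dis0.
    by move=> F _ FP _ x [P /FP]; apply.
  exists L; split=> // x xdis.
  apply: (maxL _ (subgrp_add sL (subgrp_cyclic x))).
  - by move=> y Ly; apply: subgrp_addl => //; exact: subgrp_cyclic.
  - by move=> _ [a [_ [La [c ->] ->]]]; apply: xdis.
  - by apply: subgrp_addr => //; exists 1; rewrite mulr1z.
pose pmul (x : G) := exists y, x = y *+ p.
have spmul : subgrp pmul.
  split; first by exists 0; rewrite mul0rn.
  by move=> _ _ [x ->] [y ->]; exists (x - y); rewrite mulrnBl.
have s0 := subgrp0 G.
(* [C] is maximal with trivial intersection with [pG], so that [pC = 0]; then [P] is maximal among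
   the subgroups over [pG] that meet [C] trivially. *)
have [|C [sC _ CpG maxC]] := maxdis _ pmul s0; first by move=> x ->.
have [|P [sP pP PC maxP]] := maxdis _ C spmul; first by move=> x ? ?; exact: CpG.
exists P; split=> // [x Px xp|a].
- apply: contrapT => nx.
  suff Cx : C x by case: nx; rewrite (PC x) //; case: spmul.
  (* For [c] prime to [p]: an element [a + x *~ c] of [pG] lies in [P], so [a] is in both [P] and
     [C] and vanishes, and [x] would be in [pG]. *)
  apply: maxC => a c Ca [y yE].
  have [pc|/negP pc] := boolP (p %| c)%Z.
    rewrite (mulrz_dvd xp pc) addr0 in yE *.
    by apply: CpG => //; exists y.
  case: nx; have [d ->] := @mulrz_bezout _ p_prime _ x c 1 pc xp.
  apply: (subgrpMz d spmul); exists y; rewrite -yE.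
  suff -> : a = 0 by rewrite add0r.
  apply: PC => //; rewrite -[a](addrK (x *~ c)).
  by apply: (proj2 sP); [apply: pP; exists y|apply: subgrpMz].
- suff [x [b [Px Cb ->]]] : sumgrp P C a.
    exists x => //; rewrite addrC addKr; apply: CpG; first exact: subgrpMn.
    by exists b.
  apply: contrapT => na; suff Pa : P a by case: na; apply: subgrp_addl.
  apply: maxP => x c Px Cxc.
  have [pc|/negP pc] := boolP (p %| c)%Z.
    apply: PC => //; apply: subgrpD => //.
    by case/dvdzP: pc => d ->; rewrite mulrzA; apply: pP; exists (a *~ d).
  case: na; have /asboolP[k ak] := pG a.
  have [d ->] := mulrz_bezout p_prime pc ak; apply: (subgrpMz d (subgrp_add sP sC)).
  exists (- x), (x + a *~ c); split=> //; first exact: subgrpN.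
  by rewrite addKr.
Qed.

Theorem multiples_dichotomy_semi G : abelian_pgroup p G -> multiples_dichotomy p G ->
  semi_generalized_co_Bassian G.
Proof.
move=> pG dichG H phi phi_inj.
have [N divN] := multiples_dichotomy_divisible pG dichG.
have [P [sP Pp PG]] := elementary_decomposition pG.
have PGj a j : exists2 x, P x & a *+ p ^ j.+1 = x *+ p ^ j.+1.
  have [x Px /eqP] := PG a; rewrite mulrnBl subr_eq0 => /eqP xa.
  by exists x; rewrite // !mulrn_powS xa.
(* Only [phi P] is sure to keep heights: the elementary complement may gain height in the quotient,
   and enters through the socle [S] instead. *)
have pureY : socle_pure p (fun u => exists2 a, P a & u = phi a).
  apply: (socle_pure_image pG phi_inj) => -[|j].
    by left=> x Px _; exists x.
  case: (dichG j) => [soc1|finj]; [left|right] => //.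
  move=> x Px xp; have [|y ->] := soc1 x; last exact: PGj.
  by split=> //; exact: Pp.
have pX := pgroup_quot (H := H) pG; have divX := divisible_from_quot (H := H) divN.
pose S (u : Quotient.quot H) := (exists2 a, True & u = phi a) /\ u *+ p = 0.
have sS : subgrp S.
  have [|sT0 sTB] := @subgrp_image _ _ phi (fun=> True); first by [].
  split; first by split=> //; rewrite mul0rn.
  move=> u v [Tu up] [Tv vp]; split; first exact: sTB.
  by rewrite mulrnBl up vp subrr.
have [||C [sC YC pureYC SE]] :=
  socle_pure_extension p_prime pX divX (subgrp_image phi sP) pureY sS.
- by move=> u [].
- by move=> _ [a Pa ->] up; split=> //; exists a.
set K := sumgrp _ C in pureYC SE.
have sK : subgrp K by apply: subgrp_add => //; exact: subgrp_image.
exists (zmod_of sK); first exact: socle_pure_summand pX divX pureYC.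
split=> [u|T TK [t Tt t0]].
  rewrite unfold_in => /asboolP[a <-]; apply/zmod_ofP.
  have [x Px axp] := PG a; rewrite -(subrK x a) raddfD.
  apply: subgrpD => //; last by apply: subgrp_addl => //; exists x.
  have /SE[] // : S (phi (a - x)).
  by split; [exists (a - x)|rewrite -raddfMn axp raddf0].
have [[u [Tu up u0]]|nu] := pselect (exists u, [/\ u \in T, u *+ p = 0 & u != 0]).
  exists u; split=> //; have /SE[[a _ ->] _] : K u /\ u *+ p = 0.
    by split=> //; apply/zmod_ofP/TK.
  by rewrite unfold_in; apply/asboolP; exists a.
case/eqP: t0; apply: (socle_trivial pX (subgrp_zmodClosed T)) => // u Tu up.
by apply/eqP; apply: contrapT => /negP u0; case: nu; exists u.
Qed.

End Summands.

(** * Translation of the dichotomy between G and pG *)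

Section Multiples.
Variables (p : nat) (G : zmodType).
Local Notation pG := (multiples G p).

Lemma multiples_val (u : pG) : exists x : G, val u = x *+ p.
Proof. by have := valP u; rewrite unfold_in => /asboolP[x <-]; exists x. Qed.

Lemma multiples_of (x : G) : exists u : pG, val u = x *+ p.
Proof.
have xp : x *+ p \in img (nmul (V := G) p) by rewrite unfold_in; apply/asboolP; exists x.
by exists (Sub (x *+ p) xp); rewrite SubK.
Qed.

Lemma multiples_valMn (u : pG) n : val (u *+ n) = val u *+ n.
Proof. exact: raddfMn. Qed.

Lemma multiples_pgroup : abelian_pgroup p G -> abelian_pgroup p pG.
Proof.
move=> pgG u; have /asboolP[k uk] := pgG (val u); apply/asboolP; exists k.
by apply: val_inj; rewrite multiples_valMn uk.
Qed.

Lemma multiples_powP (u : pG) m :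
  (exists v, u = v *+ p ^ m) <-> exists y : G, val u = y *+ p ^ m.+1.
Proof.
split=> [[v ->]|[y uE]].
  have [y vE] := multiples_val v; exists y.
  by rewrite multiples_valMn vE mulrn_powS.
have [v vE] := multiples_of y; exists v; apply: val_inj.
by rewrite multiples_valMn vE uE mulrn_powS.
Qed.

Lemma multiples_socleP (u : pG) : u *+ p = 0 <-> (val u : G) *+ p = 0.
Proof.
by rewrite -multiples_valMn; split=> [->|up0] //; apply: val_inj.
Qed.

Lemma multiples_psocP (u : pG) m : psoc p m u <-> psoc p m.+1 (val u : G).
Proof. by rewrite /psoc multiples_socleP multiples_powP. Qed.

Lemma multiples_dichotomyP : multiples_dichotomy p G <-> prank_dichotomy p pG.
Proof.
have psocE (x : G) m : psoc p m.+1 x -> exists u : pG, val u = x.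
  move=> [_ [y ->]]; rewrite mulrn_powSr; exact: multiples_of.
have finE m : finite_set (@psoc p G m.+1) <-> finite_set (@psoc p pG m).
  split=> fin.
    suff -> : @psoc p pG m = (val @^-1` @psoc p G m.+1)%classic.
      by apply: finite_preimage => // u v _ _; exact: val_inj.
    by apply/seteqP; split=> u; rewrite /= multiples_psocP.
  apply: (sub_finite_set _ (finite_image (val : pG -> G) fin)) => x xm.
  have [u uE] := psocE _ _ xm; exists u => //.
  by apply/multiples_psocP; rewrite uE.
split=> dich m; case: (dich m) => [soc|/finE]; [left|by right|left|by right].
  move=> u /multiples_socleP up; apply/multiples_powP/soc; split=> //.
  exact: multiples_val.
move=> x x1; have [u uE] := psocE _ _ x1; rewrite -uE.
by apply/multiples_powP/soc/multiples_socleP; rewrite uE; case: x1.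
Qed.

End Multiples.

(** * Necessity of the dichotomy *)

Section LinearCombinations.
Variables (V : zmodType) (w : nat -> V).

Definition lincomb n (c : nat -> int) : V := \sum_(i < n) w i *~ c i.

Lemma lincomb_widen m n c : (n <= m)%N ->
  lincomb n c = lincomb m (fun i => if (i < n)%N then c i else 0).
Proof.
move=> nm; rewrite /lincomb (big_ord_widen m (fun i => w i *~ c i) nm) big_mkcond.
by apply: eq_bigr => i _; case: ifP.
Qed.

Definition span (x : V) : Prop := exists n c, x = lincomb n c.

Lemma subgrp_span : subgrp span.
Proof.
split; first by exists 0%N, (fun=> 0); rewrite /lincomb big_ord0.
move=> _ _ [m [c ->]] [n [d ->]]; exists (m + n)%N.
rewrite (lincomb_widen c (leq_addr n m)) (lincomb_widen d (leq_addl m n)).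
exists (fun i => (if (i < m)%N then c i else 0) - (if (i < n)%N then d i else 0)).
by rewrite /lincomb -sumrB; apply: eq_bigr => i _; rewrite mulrzBr.
Qed.

Lemma span_gen i : span (w i).
Proof.
exists i.+1, (fun j => (j == i)%:Z); rewrite /lincomb big_ord_recr /= eqxx mulr1z.
by rewrite big1 ?add0r // => j _; rewrite ltn_eqF ?mulr0z.
Qed.

End LinearCombinations.

Lemma lincomb_pair (V W : zmodType) (w : nat -> V) (g : nat -> W) n c :
  lincomb (fun i => (w i, g i)) n c = (lincomb w n c, lincomb g n c).
Proof.
rewrite /lincomb; elim: n => [|n IHn]; first by rewrite !big_ord0.
by rewrite !big_ord_recr /= IHn pairMz.
Qed.

Lemma raddf_lincomb (V W : zmodType) (h : {additive V -> W}) (w : nat -> V) n c :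
  h (lincomb w n c) = lincomb (h \o w) n c.
Proof. by rewrite /lincomb raddf_sum; apply: eq_bigr => i _; rewrite raddfMz. Qed.

Lemma lincomb_eq0 (V : zmodType) (w : nat -> V) n c m :
  (forall i, (i < n)%N -> (m i %| c i)%Z) -> (forall i, w i *~ m i = 0) ->
  lincomb w n c = 0.
Proof.
move=> mc wm; rewrite /lincomb big1 // => i _.
by have /dvdzP[d ->] := mc i (ltn_ord i); rewrite mulrC mulrzA wm mul0rz.
Qed.

Lemma malg_divisible (P : zmodType) (I : choiceType) (e : {malg P[I]}) n :
  (forall i, exists a, e@_i = a *+ n) -> exists e' : {malg P[I]}, e = e' *+ n.
Proof.
move=> /choice[a aE]; exists [malg i in msupp e => a i]; apply/malgP => i.
by rewrite mcoeffMn mcoeffE; case: msuppP => // _; rewrite mul0rn.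
Qed.

(* A has independent elements w_i of order p^(f i + 1), w_0 = x, and E is generated
   by countably many elements u_i with p^(f (i + 1) + 1) u_i = 0.  Let q and mu : A -> E
   extend w_0 |-> 0, w_(i + 1) |-> u_i and an injective map on the span W of the w_i,
   and let H be the kernel of q on W, so that W / H = E.  Then x |-> x + H + (mu - q)(x)
   is injective: it maps only W to E, and coincides with mu there. *)
Section Embedding.
Variables (p : nat) (p_prime : prime p) (A : zmodType) (pA : abelian_pgroup p A).
Variables (N : A -> Prop) (sN : subgrp N) (w : nat -> A) (f : nat -> nat).
Hypothesis w_order : forall i, w i *+ p ^ (f i).+1 = 0.
Hypothesis w_indep : forall n c, N (lincomb (fun i => w i *+ p ^ f i) n c) ->
  forall i, (i < n)%N -> (p %| c i)%Z.

(** Independence is assumed only for the socle elements [w i *+ p ^ f i]. It lifts to the [w i] by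
    descent on a power [p ^ t]: the multiple [lincomb w n c *+ p ^ t] is a combination of those
    socle elements with coefficients [d], and [p] dividing [d] removes one factor [p]. *)
Lemma lincomb_order n c : N (lincomb w n c) ->
  forall i, (i < n)%N -> ((p ^ (f i).+1)%N %| c i)%Z.
Proof.
move=> Nc.
have [t tE] : exists t, forall i, (i < n)%N -> ((p ^ (f i).+1)%N %| (p ^ t)%N%:Z * c i)%Z.
  exists (\max_(i < n) (f i).+1) => i i_n; rewrite dvdz_mulr //.
  by rewrite dvdzE /= dvdn_exp2l // (leq_bigmax (Ordinal i_n)).
elim: t tE => [|t IHt] tE.
  by move=> i /tE; rewrite expn0 mul1r.
apply: IHt.
pose d i := (((p ^ t)%N%:Z * c i) %/ (p ^ f i)%N)%Z.
have dE i : (i < n)%N -> (p ^ t)%N%:Z * c i = d i * (p ^ f i)%N.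
  have p0 : p%:Z != 0 by rewrite eqz_nat -lt0n prime_gt0.
  by move=> /tE; rewrite !expnS !PoszM -mulrA dvdz_mul2l // => /divzK.
have pd := w_indep (c := d) (n := n) _.
move=> i i_n; rewrite dE // expnS PoszM; apply: dvdz_mul => //; apply: pd => //.
suff -> : lincomb (fun i => w i *+ p ^ f i) n d = lincomb w n c *+ p ^ t.
  exact: subgrpMn.
rewrite /lincomb -sumrMnl; apply: eq_bigr => j _.
by rewrite !pmulrn -!mulrzA [_ * d j]mulrC -dE // mulrC.
Qed.

(** Since the maps vanish on [N], a value [e] at [a *+ p] satisfies every relation that [N] imposes
    on [a *+ p]. The second hypothesis asks for divisibility by [p] of such values only, which
    cyclic groups can satisfy. *)
Lemma lincomb_extension (E : zmodType) (g : nat -> E) :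
  (forall i, g i *+ p ^ (f i).+1 = 0) ->
  (forall (a : A) (e : E), (forall j, N (a *+ p *+ p ^ j) -> e *+ p ^ j = 0) ->
     exists e', e = e' *+ p) ->
  exists h : {additive A -> E}, (forall i, h (w i) = g i) /\ forall a, N a -> h a = 0.
Proof.
move=> g_order E_ext.
pose wg i := (w i, g i); pose N0 (u : A * E) := N u.1 /\ u.2 = 0.
have sN0 : subgrp N0.
  split; first by split=> //; case: sN.
  move=> [a _] [b _] [/= Na ->] [/= Nb ->]; split; last exact: subrr.
  exact: (proj2 sN).
have [||h hE] := baer_extension p_prime pA (subgrp_add (subgrp_span wg) sN0).
- move=> e [_ [[b e'] [[n [c ->]] [/= Nb ->]]]].
  rewrite lincomb_pair => -[/esym/eqP]; rewrite addr_eq0 => /eqP wb ->.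
  rewrite addr0; apply: (lincomb_eq0 (m := fun i => (p ^ (f i).+1)%N)) => [|i].
    by apply: lincomb_order; rewrite wb; exact: subgrpN.
  by rewrite -pmulrn.
- move=> G sG G0G fG a e Ge; apply: (E_ext a) => j Nj.
  apply: fG; have G1 := subgrpMn (p ^ j) sG Ge.
  have G2 : G (a *+ p *+ p ^ j, 0).
    by apply: G0G; apply: subgrp_addr => //; exact: subgrp_span.
  have := proj2 sG _ _ G1 G2; rewrite pairMnE.
  have pairB (b b' : A) (d d' : E) : (b, d) - (b', d') = (b - b', d - d') by [].
  by rewrite pairB /= subrr subr0.
exists h; split=> [i|a Na]; apply: hE.
  by apply: subgrp_addl => //; exact: (span_gen wg).
by apply: subgrp_addr => //; exact: subgrp_span.
Qed.

Variables (P : zmodType) (v : nat -> P) (k : nat).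
Hypothesis f0 : f 0 = 0%N.
Hypothesis v_gen : forall a, exists l (r : int), a = v l *~ r.
Hypothesis v_order : forall i, v (f i) *+ p ^ (f i).+1 = 0.
Hypothesis v_order_dvd :
  forall i (c : int), v (f i) *~ c = 0 -> ((p ^ (f i).+1)%N %| c)%Z.

(* enumerates the generators v_l of the j-th copy of P *)
Let pos (i : nat) : nat * nat := odflt (0, 0)%N (choice.unpickle i).

Hypothesis v_pos_order : forall i, v (pos i).2 *+ p ^ (f i.+1).+1 = 0.
Hypothesis P_ext : forall (a : A) (e : P),
  (forall j, N (a *+ p *+ p ^ j) -> e *+ p ^ j = 0) -> exists e', e = e' *+ p.
Hypothesis v0_div : exists u, v 0 = u *+ p ^ k.+1.
Hypothesis P_torsion_div : forall e : P, e *+ p ^ k.+1 = 0 -> exists e', e = e' *+ p.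
Hypothesis w_height : forall n c a b, lincomb (fun i => w i.+1) n c = a + b *+ p ->
  a *+ p ^ k.+1 = 0 -> exists b', lincomb (fun i => w i.+1) n c = b' *+ p.

Lemma exists_embedding : exists (H : zmodClosed A) (phi : {additive A -> Quotient.quot H}),
  [/\ injective phi, exists u, phi (w 0) = u *+ p ^ k.+1 &
    forall a, a *+ p ^ k.+1 = 0 -> (exists u, phi a = u *+ p) ->
      exists b c, a = b *+ p + w 0 *~ c].
Proof.
pose E : zmodType := {malg P[nat]}.
have E_ext (a : A) (e : E) :
    (forall j, N (a *+ p *+ p ^ j) -> e *+ p ^ j = 0) -> exists e', e = e' *+ p.
  move=> Ne; apply: malg_divisible => i; apply: (P_ext (a := a)) => j /Ne ej.
  by rewrite -mcoeffMn ej mcoeff0.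
pose gq i : E := if i is i'.+1 then << v (pos i').2 *g (pos i').1 >> else 0.
(* Each [w i] receives a copy of [P] of its own and an element of its own order, hence injectivity
   on the span. *)
pose gm i : E := << v (f i) *g i >>.
have [|q [qw qN]] := @lincomb_extension E gq _ E_ext.
  by case=> [|i]; rewrite /= ?mul0rn // -monalgUMn v_pos_order monalgU0.
have [|mu [muw muN]] := @lincomb_extension E gm _ E_ext.
  by move=> i; rewrite -monalgUMn v_order monalgU0.
have sW := subgrp_span w.
have q_surj e : exists a, span w a /\ q a = e.
  have sI := subgrp_image q sW.
  suff [a Wa ->] : exists2 a, span w a & e = q a by exists a.
  rewrite [e]monalgE; apply: (subgrp_sum (P := fun e => exists2 a, _ a & e = q a)) => // j.
  have [l [r ->]] := v_gen e@_j.
  exists (w (choice.pickle (j, l)).+1 *~ r); first by apply: subgrpMz => //; exact: span_gen.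
  by rewrite raddfMz qw /= /pos choice.pickleK /= (raddfMz (mkmalgU j)).
have mu_inj a : span w a -> mu a = 0 -> a = 0.
  move=> [n [c ->]]; rewrite raddf_lincomb => mu0.
  apply: (lincomb_eq0 (m := fun i => (p ^ (f i).+1)%N)) => [i i_n|i]; last by rewrite -pmulrn.
  apply: v_order_dvd; have := congr1 (mcoeff i) mu0.
  rewrite mcoeff0 /lincomb raddf_sum (bigD1 (Ordinal i_n)) //= big1 ?addr0.
    by rewrite muw (raddfMz (mcoeff i)) /gm /= mcoeffUU.
  move=> j /eqP ij; rewrite muw (raddfMz (mcoeff i)) /gm /= mcoeffU.
  by case: eqP => [ji|]; [case: ij; exact: val_inj|rewrite mul0rz].
have sH : subgrp (fun a => span w a /\ q a = 0).
  split; first by split; [case: sW|rewrite raddf0].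
  move=> a b [Wa qa] [Wb qb]; split; first exact: (proj2 sW).
  by rewrite raddfB qa qb subrr.
pose H := zmod_of sH.
have /choice[s sP] := q_surj.
(* The inverse of the isomorphism from [W / H] to [E] induced by [q]; two preimages in the span
   differ by an element of [H]. *)
pose iota e := qproj H (s e).
have iotaB : zmod_morphism iota.
  move=> e e'; rewrite /iota -raddfB; apply/qproj_eq/zmod_ofP.
  have [We qe] := sP e; have [We' qe'] := sP e'; have [Wd qd] := sP (e - e').
  split; first by do 2?apply: (proj2 sW).
  by rewrite !(raddfB q) qe qe' qd subrr.
pose iotaA : {additive E -> Quotient.quot H} :=
  HB.pack iota (GRing.isZmodMorphism.Build _ _ iota iotaB).
pose theta a := mu a - q a.
pose phi a := qproj H a + iotaA (theta a).
have thetaB a b : theta (a - b) = theta a - theta b.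
  by rewrite /theta (raddfB mu) (raddfB q) !opprD opprK addrACA.
have phiB : zmod_morphism phi.
  move=> a b; rewrite /phi thetaB (raddfB iotaA) (raddfB (qproj H)).
  by rewrite opprD addrACA.
pose Phi : {additive A -> Quotient.quot H} :=
  HB.pack phi (GRing.isZmodMorphism.Build _ _ phi phiB).
exists H, Phi; split.
- apply: raddf_inj => a; rewrite -[Phi a]/(phi a) /phi -[iotaA _]/(iota _) /iota.
  rewrite -qprojD => /qproj_eq0/zmod_ofP[Was qas].
  have [Ws qs] := sP (theta a).
  have Wa : span w a by rewrite -[a](addrK (s (theta a))); apply: (proj2 sW).
  apply: mu_inj => //; move: qas; rewrite (raddfD q) qs /theta.
  by rewrite addrC subrK.
- have [u uE] := v0_div; exists (iotaA << u *g 0%N >>).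
  rewrite -raddfMn -monalgUMn -uE -[Phi _]/(phi _) /phi.
  have -> : qproj H (w 0) = 0.
    by apply/qproj_eq0/zmod_ofP; split; [exact: span_gen|rewrite qw].
  by rewrite add0r /theta muw qw subr0 /gm f0.
(* [theta a] is killed by [p ^ k.+1], hence divisible by [p] in [E]. So [a] lies in [pA] up to a
   combination of the [w i], whose part beyond [w 0] is divisible by [p] by [w_height]. *)
- move=> a ak [u]; rewrite -[Phi a]/(phi a) /phi => aE.
  have [e eE] : exists e, theta a = e *+ p.
    apply: malg_divisible => i; apply: P_torsion_div; rewrite -mcoeffMn.
    suff -> : theta a *+ p ^ k.+1 = 0 by rewrite mcoeff0.
    by rewrite /theta mulrnBl -(raddfMn mu) -(raddfMn q) ak (raddf0 mu) (raddf0 q) subrr.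
  have [b bE] := qproj_surj (u - iota e).
  have : qproj H a = qproj H (b *+ p).
    rewrite qprojMn -bE mulrnBl -aE eE; apply/esym/eqP.
    by rewrite subr_eq (raddfMn iotaA).
  move=> /qproj_eq/zmod_ofP[[[|n] [c abE]] _].
    exists b, 0; rewrite mulr0z addr0; apply/eqP; rewrite -subr_eq0 abE.
    by rewrite /lincomb big_ord0.
  move: abE; rewrite /lincomb big_ord_recl -/(lincomb (fun i => w i.+1) n (fun i => c i.+1)).
  move=> abE; have lE : lincomb (fun i => w i.+1) n (fun i => c i.+1) =
      (a - w 0 *~ c 0%N) + (- b) *+ p.
    by apply: (addrI (w 0 *~ c 0%N)); rewrite -abE addrA [w 0 *~ _ + _]addrC subrK mulNrn.
  have [|b' b'E] := w_height lE.
    rewrite mulrnBl ak sub0r -mulrnzC.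
    have -> : w 0 *+ p ^ k.+1 = 0 by apply: mulrn_pow0 (w_order 0); rewrite f0.
    by rewrite mul0rz oppr0.
  exists (b + b'), (c 0%N); move/eqP: abE; rewrite subr_eq => /eqP ->.
  by rewrite b'E mulrnDl -addrA [RHS]addrC [b' *+ p + _]addrC.
Qed.

End Embedding.

(** * Generators of Prüfer and cyclic groups *)

Section Prufer.
Variables (p : nat) (p_prime : prime p).

Local Notation QZ := (Quotient.quot (img (intr : {additive int -> rat}))).

Lemma img_intrP (x : rat) : x \in img (intr : {additive int -> rat}) <-> exists m : int, x = m%:~R.
Proof.
by rewrite unfold_in; split=> [/asboolP[m <-]|[m ->]]; [exists m|apply/asboolP; exists m].
Qed.

Definition prufer_frac (l : nat) : QZ := qproj _ ((p ^ l.+1)%:R^-1).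

Lemma pexp_neq0 l : (p ^ l)%:R != 0 :> rat.
Proof. by rewrite pnatr_eq0 -lt0n expn_gt0 prime_gt0. Qed.

Lemma mulrn_invr k : (0 < k)%N -> k%:R^-1 *+ k = 1 :> rat.
Proof. by move=> k0; rewrite -[LHS]mulr_natl mulfV // pnatr_eq0 -lt0n. Qed.

Lemma prufer_frac_primary l : prufer_frac l \in primary p QZ.
Proof.
rewrite unfold_in; apply/asboolP; exists l.+1; rewrite -qprojMn.
apply/qproj_eq0/img_intrP; exists 1.
by rewrite mulrn_invr // expn_gt0 prime_gt0.
Qed.

Definition prufer_elt (l : nat) : prufer p := Sub (prufer_frac l) (prufer_frac_primary l).

Lemma prufer_eltS l : prufer_elt l = prufer_elt l.+1 *+ p.
Proof.
apply: val_inj; rewrite raddfMn !SubK -qprojMn; congr qproj.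
have p0 : p%:R != 0 :> rat by rewrite pnatr_eq0 -lt0n prime_gt0.
by rewrite [in RHS]expnS natrM invfM -[RHS]mulr_natl mulrA mulfV // mul1r.
Qed.

Lemma prufer_elt0 : prufer_elt 0 *+ p = 0.
Proof.
apply: val_inj; rewrite raddfMn !SubK -qprojMn.
apply/qproj_eq0/img_intrP; exists 1.
by rewrite mulrn_invr // prime_gt0.
Qed.

Lemma prufer_elt_neq0 : prufer_elt 0 != 0.
Proof.
apply/eqP => /(congr1 val); rewrite SubK => /qproj_eq0/img_intrP[m mE].
have : (m * p)%:~R = 1 :> rat by rewrite intrM -mE mulVf // (pexp_neq0 1).
move=> /eqP; rewrite -[1]/(1%:~R) eqr_int => /eqP mp1.
have : (p %| 1)%Z by apply/dvdzP; exists m.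
by rewrite dvdzE /= dvdn1 => /eqP p1; move: p_prime; rewrite p1.
Qed.

Lemma prufer_gen (a : prufer p) : exists l (r : int), a = prufer_elt l *~ r.
Proof.
have [x xE] := qproj_surj (val a).
have /asboolP[k ak] : `[< exists k, val a *+ p ^ k = 0 >] by have := valP a; rewrite unfold_in.
move: ak; rewrite xE -qprojMn => /qproj_eq0/img_intrP[m mE].
(* From [x *+ p ^ k = m] follows [x = m p / p ^ k.+1]; the extra [p] compensates the index shift, as
   [prufer_elt k] has order [p ^ k.+1]. *)
exists k, (m * p); apply: val_inj.
have -> : val (prufer_elt k *~ (m * p)) = prufer_frac k *~ (m * p) by rewrite raddfMz.
rewrite xE -(raddfMz (qproj _)).
congr qproj; apply: (mulIf (pexp_neq0 k.+1)).
rewrite -[in RHS]mulrzl mulfVK ?pexp_neq0 //.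
by rewrite intrM -mE expnSr natrM mulrA -(mulr_natr x).
Qed.

Lemma prufer_elt_pow l : prufer_elt l *+ p ^ l = prufer_elt 0.
Proof. by elim: l => [|l IHl]; rewrite ?mulr1n // mulrn_powS -prufer_eltS. Qed.

Lemma prufer_divisible (a : prufer p) : exists b, a = b *+ p.
Proof.
have [l [r ->]] := prufer_gen a; exists (prufer_elt l.+1 *~ r).
by rewrite prufer_eltS mulrnzC.
Qed.

End Prufer.

Section Cyclic.
Variables (p n : nat) (p_prime : prime p).

Local Notation C := (Zp_exponent p (Some n)).

Definition cyclic_gen : C := inZp 1 : 'I_(p ^ n).-1.+1.

Lemma cyclic_genMn k : cyclic_gen *+ k = inZp k :> 'I_(p ^ n).-1.+1.
Proof. by rewrite /cyclic_gen Zp_mulrn; apply/val_inj; rewrite /= modnMml mul1n. Qed.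

Lemma cyclic_gen_dvd k : cyclic_gen *+ k = 0 <-> (p ^ n %| k)%N.
Proof.
rewrite cyclic_genMn -[X in (X %| _)%N]prednK ?expn_gt0 ?prime_gt0 //.
by split=> [/(congr1 val) /= /eqP|/eqP kE]; last apply/val_inj.
Qed.

Lemma cyclic_gen_span (a : C) : a = cyclic_gen *+ val (a : 'I_(p ^ n).-1.+1).
Proof. by rewrite cyclic_genMn valZpK. Qed.

Lemma cyclic_exp (a : C) : a *+ p ^ n = 0.
Proof.
rewrite (cyclic_gen_span a) -mulrnA mulnC mulrnA.
by rewrite (_ : _ *+ p ^ n = 0) ?mul0rn //; apply/cyclic_gen_dvd.
Qed.

Lemma cyclic_div (a : C) k m : (m + k = n)%N -> a *+ p ^ k = 0 -> exists b, a = b *+ p ^ m.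
Proof.
move=> mk; rewrite (cyclic_gen_span a) -mulrnA => /cyclic_gen_dvd.
rewrite -[X in (p ^ X %| _)%N]mk expnD dvdn_pmul2r ?expn_gt0 ?prime_gt0 // => /dvdnP[d ->].
by exists (cyclic_gen *+ d); rewrite mulrnA.
Qed.

End Cyclic.

(** * Independent families in the socle *)

Section IndependentFamily.
Variables (p : nat) (p_prime : prime p) (A : zmodType).

Lemma finite_lincomb (z : nat -> A) n : (forall i, z i *+ p = 0) ->
  finite_set [set lincomb z n c | c in setT]%classic.
Proof.
move=> zp; elim: n => [|n IHn].
  apply: (@sub_finite_set _ _ [set 0]%classic); last exact: finite_set1.
  by move=> _ [c _ <-]; rewrite /lincomb big_ord0.
have finI := finite_II p.
apply: (sub_finite_set _ (finite_image2 (fun y (r : nat) => y + z n *+ r) IHn finI)).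
move=> _ [c _ <-]; rewrite /lincomb big_ord_recr /=.
exists (lincomb z n c); first by exists c.
have p0 : p%:Z != 0 by rewrite eqz_nat -lt0n prime_gt0.
exists `|c n %% p|%Z%N.
  by rewrite /= -ltz_nat gez0_abs ?modz_ge0 // ltz_pmod // ltz_nat prime_gt0.
congr (_ + _); rewrite [in RHS](divz_eq (c n) p) mulrzDr mulrC mulrzA.
by rewrite -pmulrn zp mul0rz add0r -{2}(gez0_abs (modz_ge0 (c n) p0)).
Qed.

Lemma lincombMz (z : nat -> A) n c (d : int) : lincomb z n c *~ d = lincomb z n (fun i => c i * d).
Proof.
rewrite /lincomb; elim: n => [|n IHn]; first by rewrite !big_ord0 mul0rz.
by rewrite !big_ord_recr /= mulrzDl IHn mulrzA.
Qed.

(** Greedy choice: the combinations of the elements chosen so far, translated by the finite socle of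
    [N], form a finite set and cannot exhaust an infinite socle. *)
Lemma exists_independent (N : A -> Prop) (g : nat -> nat) (x : A) :
  subgrp N -> finite_set [set y | N y /\ y *+ p = 0]%classic ->
  x *+ p = 0 -> ~ N x -> (forall i, infinite_set (@psoc p A (g i))) ->
  exists z : nat -> A, [/\ z 0 = x, forall i, psoc p (g i) (z i.+1) &
    forall n c, N (lincomb z n c) -> forall i, (i < n)%N -> (p %| c i)%Z].
Proof.
move=> sN finN xp nx infg.
pose R (s : seq A) t := psoc p (g (size s).-1) t /\
  forall c, ~ N (t - lincomb (nth 0 s) (size s) c).
have /choice[next nextP] s : exists t, (forall i, s`_i *+ p = 0) -> R s t.
  have [sp|nsp] := pselect (forall i, s`_i *+ p = 0); last by exists 0.
  have fin := finite_image2 +%R finN (finite_lincomb (size s) sp).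
  have [t [tg tN]] := infinite_setN0 (infinite_setD (infg (size s).-1) fin).
  exists t => _; split=> // c Nt; apply: tN.
  exists (t - lincomb (nth 0 s) (size s) c).
    split=> //; rewrite mulrnBl; case: tg => -> _.
    rewrite /lincomb -sumrMnl big1 ?subrr // => i _.
    by rewrite -mulrnzC sp mul0rz.
  exists (lincomb (nth 0 s) (size s) c); first by exists c.
  by rewrite subrK.
pose F n := iter n (fun s => rcons s (next s)) [:: x].
have sizeF n : size (F n) = n.+1 by elim: n => //= n IHn; rewrite size_rcons IHn.
pose z n := (F n)`_n.
have zF n i : (i <= n)%N -> (F n)`_i = z i.
  elim: n => [|n IHn]; first by rewrite leqn0 => /eqP ->.
  rewrite leq_eqVlt => /orP[/eqP -> //|i_n].
  by rewrite /= nth_rcons sizeF i_n; apply: IHn.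
have zp n : forall i, (F n)`_i *+ p = 0.
  elim: n => [|n IHn] i; first by case: i => [|i]; rewrite /= ?nth_nil ?mul0rn.
  rewrite /= nth_rcons; case: ifP => // _; case: ifP => _; last exact: mul0rn.
  by case: (nextP _ IHn) => -[].
have zS n : z n.+1 = next (F n) by rewrite /z /= nth_rcons sizeF ltnn eqxx.
have zN n c : ~ N (z n - lincomb z n c).
  case: n => [|n]; first by rewrite /lincomb big_ord0 subr0.
  rewrite zS; have [_ /(_ c)] := nextP _ (zp n); rewrite sizeF.
  suff -> : lincomb (nth 0 (F n)) n.+1 c = lincomb z n.+1 c by [].
  by apply: eq_bigr => i _; rewrite zF // -ltnS.
exists z; split=> // [i|].
  by rewrite zS; case: (nextP _ (zp i)); rewrite sizeF.
elim=> [|n IHn] c; first by [].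
rewrite /lincomb big_ord_recr /= -/(lincomb z n c) => Nc i.
have zpn : z n *+ p = 0 by have := zp n n.
have pc : (p %| c n)%Z.
  apply: contrapT => pc; have [d zE] := @mulrz_bezout _ p_prime _ (z n) (c n) 1 pc zpn.
  apply: (zN n (fun i => - (c i * d))).
  have -> : z n - lincomb z n (fun i => - (c i * d)) = (lincomb z n c + z n *~ c n) *~ d.
    rewrite mulrzDl -zE lincombMz addrC; congr (_ + _).
    by rewrite /lincomb -sumrN; apply: eq_bigr => j _; rewrite mulrNz opprK.
  exact: subgrpMz.
rewrite ltnS leq_eqVlt => /orP[/eqP -> //|]; apply: IHn.
by move: Nc; rewrite (mulrz_dvd zpn pc) addr0.
Qed.

End IndependentFamily.

(** * Embeddings that raise a height *)

Section Necessity.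
Variables (p : nat) (p_prime : prime p) (A : zmodType) (pA : abelian_pgroup p A).

Lemma lincombMn (z : nat -> A) n c k :
  lincomb z n c *+ k = lincomb (fun i => z i *+ k) n c.
Proof. by rewrite /lincomb -sumrMnl; apply: eq_bigr => i _; rewrite mulrnzC. Qed.

Lemma lincomb_dvd (z : nat -> A) n c : (forall i, (i < n)%N -> (p %| c i)%Z) ->
  exists y, lincomb z n c = y *+ p.
Proof.
move=> pc; exists (lincomb z n (fun i => (c i %/ p)%Z)).
rewrite /lincomb -sumrMnl; apply: eq_bigr => i _.
by rewrite -{1}(divzK (pc i (ltn_ord i))) mulrzA -pmulrn.
Qed.

(** The first two clauses refute the generalized co-Bassian property; the third serves the
    semi-generalized one, where [phi A] is only essential in a summand. *)
Lemma infinite_psoc_embedding (x : A) k : x *+ p = 0 ->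
  ~ (exists y, x = y *+ p ^ k.+1) -> infinite_set (@psoc p A k.+1) ->
  exists (H : zmodClosed A) (phi : {additive A -> Quotient.quot H}),
  [/\ injective phi, exists u, phi x = u *+ p ^ k.+1 &
    forall a, a *+ p ^ k.+1 = 0 -> (exists u, phi a = u *+ p) ->
      exists b c, a = b *+ p + x *~ c].
Proof.
move=> xp xk infk.
have p_gt0 := prime_gt0 p_prime.
have [allinf|/existsNP[m0 /contrapT finm0]] :=
  pselect (forall j, infinite_set (@psoc p A j)).
(* The same enumeration as [pos]: [w i.+1] gets the order of the generator that [q] assigns to
   it. *)
- pose lev i := (odflt (0, 0)%N (choice.unpickle i : option (nat * nat))).2.
  have s0 := subgrp0 A.
  have [||z [z0 zS zind]] := @exists_independent p p_prime A (fun y => y = 0)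
      (fun i => (lev i).+1) x s0 _ xp _ (fun i => allinf _).
  + by apply: sub_finite_set (finite_set1 0) => y [].
  + by move=> x0; apply: xk; exists 0; rewrite mul0rn.
  have /choice[y yP] i : exists y, z i.+1 = y *+ p ^ (lev i).+1 by case: (zS i).
  pose f i := if i is i'.+1 then lev i' else 0%N.
  (* The roots [y] are one step deeper than the orders require; the factor [p] makes each [w i.+1]
     divisible by [p], which settles [w_height]. *)
  pose w i := if i is i'.+1 then y i' *+ p else x.
  have wz i : w i *+ p ^ f i = z i.
    by case: i => [|i] /=; rewrite ?z0 // yP mulrn_powS.
  have zp i : z i *+ p = 0 by case: i => [|i]; [rewrite z0|case: (zS i)].
  have [|||||||||||H [phi phiP]] := @exists_embedding p p_prime A pA (fun y => y = 0) s0
    w f _ _ (prufer p) (prufer_elt p_prime) k; last by exists H, phi.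
  + by move=> i; rewrite mulrn_powSr wz zp.
  + move=> n c c0; apply: zind; rewrite -c0; apply: eq_bigr => i _.
    by rewrite wz.
  + by [].
  + exact: prufer_gen.
  + by move=> i; rewrite mulrn_powSr prufer_elt_pow prufer_elt0.
  + move=> i c; apply: (mulrz_tower_eq0 p_prime (prufer_elt0 p_prime)).
      exact: prufer_elt_neq0.
    exact: prufer_elt_pow.
  + by move=> i; rewrite mulrn_powSr prufer_elt_pow prufer_elt0.
  + by move=> _ e _; exact: prufer_divisible.
  + by exists (prufer_elt p_prime k.+1); rewrite prufer_elt_pow.
  + by move=> e _; exact: prufer_divisible.
  + move=> n c a b _ _; exists (lincomb y n c).
    by rewrite lincombMn.
have [n [kn infn finn]] : exists n, [/\ (k.+1 <= n)%N, infinite_set (@psoc p A n) &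
    finite_set (@psoc p A n.+1)].
  have ex : exists j, `[< finite_set (@psoc p A j) >] by exists m0; apply/asboolP.
  case: (ex_minnP ex) => j /asboolP finj minj.
  have kj : (k.+1 < j)%N.
    rewrite ltnNge; apply/negP => jk; apply: infk.
    by apply: sub_finite_set finj => y; exact: psoc_le.
  case: j kj finj minj => // n kn finn minn; exists n; split=> // finn'.
  by have /minn : `[< finite_set (@psoc p A n) >] by [apply/asboolP]; rewrite ltnn.
pose N (y : A) := exists y', y = y' *+ p ^ n.+1.
have sN : subgrp N.
  split; first by exists 0; rewrite mul0rn.
  by move=> _ _ [a ->] [b ->]; exists (a - b); rewrite mulrnBl.
have [||z [z0 zS zind]] := @exists_independent p p_prime A N
    (fun=> n) x sN _ xp _ (fun=> infn).
- by apply: sub_finite_set finn => y [[y' yE] yp]; split=> //; exists y'.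
- move=> [y xE]; apply: xk; exists (y *+ p ^ (n.+1 - k.+1)).
  by rewrite -mulrn_pow subnK // ltnW.
have /choice[y yP] i : exists y, z i.+1 = y *+ p ^ n by case: (zS i).
pose f i := if i is i'.+1 then n else 0%N.
pose w i := if i is i'.+1 then y i' else x.
have wz i : w i *+ p ^ f i = z i by case: i => [|i] /=; rewrite ?z0 // yP.
have zp i : z i *+ p = 0 by case: i => [|i]; [rewrite z0|case: (zS i)].
pose g := cyclic_gen p n.+1.
have ext (e : Zp_exponent p (Some n.+1)) : e *+ p ^ n = 0 -> exists e', e = e' *+ p.
  by apply: (@cyclic_div p n.+1 p_prime e n 1).
have g0p : g *+ p ^ n *+ p = 0 by rewrite -mulrn_powSr cyclic_exp.
have g0 : g *+ p ^ n != 0.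
  apply/eqP => /(cyclic_gen_dvd _ p_prime) /dvdn_leq.
  by rewrite expn_gt0 p_gt0 leq_exp2l ?prime_gt1 // ltnn => /(_ isT).
(* [v l] has order [p ^ l.+1] up to [l = n]; beyond, the generator is repeated because [pos] runs
   through all of [nat]. *)
pose v l := if (l <= n)%N then g *+ p ^ (n - l) else g.
have vf i : (f i <= n)%N by case: i => /=.
have vE l : (l <= n)%N -> v l *+ p ^ l = g *+ p ^ n.
  by move=> ln; rewrite /v ln -mulrn_pow subnK.
have [|||||||||||H [phi phiP]] := @exists_embedding p p_prime A pA N sN
    w f _ _ (Zp_exponent p (Some n.+1)) v k; last by exists H, phi.
- by move=> i; rewrite mulrn_powSr wz zp.
- move=> m c Nc; apply: zind; move: Nc; congr N; apply: eq_bigr => i _.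
  by rewrite wz.
- by [].
- by move=> a; exists n, (val (a : 'I_(p ^ n.+1).-1.+1))%:Z; rewrite -pmulrn {1}(cyclic_gen_span a)
    /v leqnn subnn.
- by move=> i; rewrite mulrn_powSr vE.
- by move=> i c; apply: (mulrz_tower_eq0 p_prime g0p g0); exact: vE.
- by move=> i; exact: cyclic_exp.
- move=> a e Ne; apply: ext; apply: Ne; exists a; by rewrite mulrn_powS.
- by exists (g *+ p ^ (n - k.+1)); rewrite /v /= subn0 -mulrn_pow subnK.
- by move=> e /(mulrn_pow0 kn); exact: ext.
(* Multiplication by [p ^ n] kills [a], as [k < n], and sends [b *+ p] into [N]; independence modulo
   [N] applies. *)
- move=> m c a b E ak; apply: lincomb_dvd => i im.
  have := congr1 (fun t => t *+ p ^ n) E; rewrite lincombMn mulrnDl (mulrn_pow0 kn ak) add0r.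
  rewrite -mulrn_powS => zE.
  pose c' i := if i is i'.+1 then c i' else 0.
  apply: (zind m.+1 c' _ i.+1) => //; exists b; rewrite -zE /lincomb big_ord_recl mulr0z add0r.
  by apply: eq_bigr => j _; rewrite /= yP.
Qed.

Theorem co_Bassian_prank_dichotomy : generalized_co_Bassian A -> prank_dichotomy p A.
Proof.
move=> coA m; have [soc|/existsNP[x /not_implyP[xp xm]]] :=
  pselect (forall x : A, x *+ p = 0 -> exists y, x = y *+ p ^ m); [by left|right].
apply: contrapT => infm.
case: m xm infm => [|k] xm infm; first by case: xm; exists x.
have [H [phi [phi_inj [u uE] _]]] := infinite_psoc_embedding xp xm infm.
have [L [dis tot]] := coA H phi phi_inj.
have [_ [l [/asboolP[y <-] Ll uyl]]] := tot u.
case: xm; exists y; apply: phi_inj; rewrite raddfMn uE uyl mulrnDl.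
suff -> : l *+ p ^ k.+1 = 0 by rewrite addr0.
apply: dis; last exact: rpredMn.
rewrite unfold_in; apply/asboolP; exists (x - y *+ p ^ k.+1).
by rewrite raddfB raddfMn uE uyl mulrnDl addrC addKr.
Qed.

(** At the least bad level, [x = y *+ p ^ k] has height exactly [k], the minimum over the socle of
    [pA]. In [K] there is [b] with [phi x = b *+ p ^ k.+1]. The element [phi y - b *+ p] of [K] is
    killed by [p ^ k], hence lies in [phi (A[p])] modulo multiples of [p]; correcting [y]
    accordingly gives an element of [pA] that is still a [p ^ k]-root of [x]. *)
Theorem semi_multiples_dichotomy : semi_generalized_co_Bassian A -> multiples_dichotomy p A.
Proof.
move=> semiA m.
pose bad j := `[< exists x : A, psoc p 1 x /\ ~ exists y, x = y *+ p ^ j.+1 >].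
have [/asboolP badm|gm] := boolP (bad m); last first.
  left=> x x1; apply: contrapT => nx; move/negP: gm; apply; apply/asboolP.
  by exists x.
right; apply: contrapT => infm.
have ex : exists j, bad j by exists m; apply/asboolP.
case: (ex_minnP ex) => k /asboolP[x [x1 xk]] mink.
have km : (k <= m)%N by apply: mink; apply/asboolP.
have soc (t : A) j : (j <= k)%N -> psoc p 1 t -> exists y, t = y *+ p ^ j.
  case: j => [|j] jk t1; first by exists t.
  apply: contrapT => nt; have /mink : bad j by apply/asboolP; exists t.
  by rewrite leqNgt jk.
have k_gt0 : (0 < k)%N by case: (k) xk => // nx; case: nx; case: x1.
have infk : infinite_set (@psoc p A k.+1).
  by apply: contra_not infm; apply: sub_finite_set => y; exact: psoc_le.
have [xp [x' xE']] := x1.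
have [y xE] := soc x k (leqnn k) x1.
have [H [phi [phi_inj [u uE] phi_ht]]] := infinite_psoc_embedding xp xk infk.
have [K [L [dis tot]] [phiK essK]] := semiA H phi phi_inj.
have phi_in a : phi a \in K by apply: phiK; rewrite unfold_in; apply/asboolP; exists a.
have proj a j u' : phi a = u' *+ p ^ j -> exists2 b, b \in K & phi a = b *+ p ^ j.
  move=> aE; have [b [l [bK lL u'E]]] := tot u'; exists b => //.
  rewrite aE u'E mulrnDl; suff -> : l *+ p ^ j = 0 by rewrite addr0.
  apply: dis; last exact: rpredMn.
  have -> : l *+ p ^ j = phi a - b *+ p ^ j by rewrite aE u'E mulrnDl addrC addKr.
  by rewrite rpredB // rpredMn.
have socK c : c \in K -> c *+ p = 0 -> exists2 t, t *+ p = 0 & c = phi t.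
  move=> cK cp; have [->|c0] := eqVneq c 0.
    by exists 0; rewrite ?mul0rn ?raddf0.
  have [||_ [/asboolP[t <-]]] := essK (zmod_of (subgrp_cyclic c)).
  - by move=> _ /zmod_ofP[d ->]; exact: rpredMz.
  - by exists c => //; apply/zmod_ofP; exists 1; rewrite mulr1z.
  move=> /zmod_ofP[d tE] t0.
  have [pd|/negP pd] := boolP (p %| d)%Z.
    by move: t0; rewrite tE (mulrz_dvd cp pd) eqxx.
  have [d' cE] := @mulrz_bezout _ p_prime _ c d 1 pd cp.
  exists (t *~ d'); last by rewrite raddfMz tE.
  by apply: phi_inj; rewrite raddfMn raddfMz tE -cE cp raddf0.
(* As [x] itself is in [pA], the exceptional multiples of [x] are absorbed. *)
have inpA t : t *+ p ^ k.+1 = 0 -> (exists v, phi t = v *+ p) -> exists b, t = b *+ p.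
  move=> tk /(phi_ht t tk)[b [c ->]]; rewrite xE'.
  by exists (b + x' *~ c); rewrite mulrnDl mulrnzC.
(* In the inductive step the socle element [c *+ p ^ j.+1] is some [phi t]; [t] is in [pA] by
   [inpA], so in [p ^ j.+2 A] by minimality of [k], and subtracting [phi a *+ p] lowers the exponent
   of [c]. *)
have KpK j c : (j <= k)%N -> c \in K -> c *+ p ^ j = 0 ->
    exists t b, t *+ p = 0 /\ c = phi t + b *+ p.
  elim: j c => [|[|j] IHj] c jk cK cj.
  - by exists 0, 0; rewrite mulr1n in cj; rewrite raddf0 !mul0rn addr0.
  - have [t tp cE] := socK c cK cj.
    by exists t, 0; rewrite mul0rn addr0.
  have [|t tp tE] := socK (c *+ p ^ j.+1) (rpredMn _ cK); first by rewrite -mulrn_powSr.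
  have [|s sE] := inpA t (mulrn_pow0 (ltn0Sn k) tp).
    by exists (c *+ p ^ j); rewrite -tE -mulrn_powSr.
  have [||a aE] := soc t j.+2 => //; first by split=> //; exists s.
  have cK' : c - phi a *+ p \in K by rewrite rpredB // rpredMn.
  have [|t' [b [t'p cE]]] := IHj _ (ltnW jk) cK'.
    by rewrite mulrnBl -mulrn_powS -raddfMn -aE tE subrr.
  exists t', (b + phi a); split=> //.
  by rewrite mulrnDl addrA -cE subrK.
have [b bK xbE] := proj x k.+1 u uE.
have [||t [b' [tp cE]]] := KpK k (phi y - b *+ p) (leqnn k).
- by rewrite rpredB // rpredMn.
- by rewrite mulrnBl -raddfMn -xE -mulrn_powS xbE subrr.
have [||s ysE] := inpA (y - t).
- by rewrite mulrnBl !mulrn_powSr -xE xp -mulrn_powSr (mulrn_pow0 (ltn0Sn k) tp) // subrr.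
- exists (b + b'); rewrite raddfB mulrnDl -[phi y](subrK (b *+ p)) cE.
  by rewrite addrAC [phi t + _]addrC addrK addrC.
apply: xk; exists s; rewrite mulrn_powS -ysE mulrnBl -xE.
by rewrite (mulrn_pow0 k_gt0 tp) subr0.
Qed.

End Necessity.

(** * Generalized finite p-rank *)

Lemma finite_by_coords (X B I : Type) (s : seq I) (ev : I -> X -> B) (S : set X) :
  (forall i, finite_set (ev i @` S)%classic) ->
  (forall x y, S x -> S y -> [seq ev i x | i <- s] = [seq ev i y | i <- s] -> x = y) ->
  finite_set S.
Proof.
move=> fin_ev ev_inj; pose g x := [seq ev i x | i <- s].
have fin_g : finite_set (g @` S)%classic.
  rewrite /g; elim: s {ev_inj g} => [|i s IHs].
    apply: (@sub_finite_set _ _ [set [::]]%classic); last exact: finite_set1.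
    by move=> _ [x _ <-].
  apply: (sub_finite_set _ (finite_image2 cons (fin_ev i) IHs)).
  by move=> _ [x Sx <-]; exists (ev i x); [exists x|exists [seq ev j x | j <- s] => //; exists x].
have [[x0 Sx0]|noS] := pselect (exists x, S x); last first.
  by apply: (@sub_finite_set _ _ set0) => // x Sx; case: noS; exists x.
have /choice[h hP] t : exists x, forall y, S y -> g y = t -> S x /\ g x = t.
  have [[x [Sx xt]]|nx] := pselect (exists x, S x /\ g x = t); first by exists x.
  by exists x0 => y Sy yt; case: nx; exists y.
apply: (sub_finite_set _ (finite_image h fin_g)) => x Sx.
exists (g x); first by exists x.
by have [Sh hx] := hP _ x Sx erefl; apply: ev_inj.
Qed.

Section ExponentGroups.
Variables (p : nat) (p_prime : prime p).
Local Notation Z := (Zp_exponent p).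

Lemma exponent_divisible s m (a : Z s) : exponent_lt (Some m) s -> a *+ p = 0 ->
  exists b, a = b *+ p ^ m.
Proof.
case: s a => [k|] a /= mk ap; last first.
  elim: m {mk ap} => [|m [b ->]]; first by exists a.
  by have [c ->] := prufer_divisible p_prime b; exists c; rewrite mulrn_powS.
case: k a mk ap => // k a mk ap.
have [b ->] := @cyclic_div p k.+1 p_prime a 1 k (addn1 k) ap.
by exists (b *+ p ^ (k - m)); rewrite -mulrn_pow subnK.
Qed.

(** The [match] is the height needed for a map with [u] sent to [t]: [k.-1] for the cyclic group of
    order [p ^ k], an infinite tower of roots for the Prüfer group. *)
Lemma exponent_socle_gen s : exponent_lt (Some 0%N) s ->
  exists u : Z s, [/\ u *+ p = 0, u != 0, forall a, a *+ p = 0 -> exists c, a = u *~ c &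
    forall (A : zmodType) (t : A), t *+ p = 0 ->
      match s with
      | Some k => exists w, t = w *+ p ^ k.-1
      | None => exists w : nat -> A, w 0 = t /\ forall l, w l = w l.+1 *+ p
      end -> exists h : {additive Z s -> A}, h u = t].
Proof.
case: s => [[//|k] _|_].
  exists (cyclic_gen p k.+1 *+ p ^ k); split.
  - by rewrite -mulrn_powSr cyclic_exp.
  - apply/eqP => /(cyclic_gen_dvd _ p_prime) /dvdn_leq.
    by rewrite expn_gt0 prime_gt0 // leq_exp2l ?prime_gt1 // ltnn => /(_ isT).
  - move=> a ap; have [b ->] := @cyclic_div p k.+1 p_prime a 1 k (addn1 k) ap.
    exists (val (b : 'I_(p ^ k.+1).-1.+1))%:Z.
    by rewrite -pmulrn {1}(cyclic_gen_span b) -!mulrnA mulnC.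
  - move=> A t tp [w tE].
    have [|a|h hE] := graph_additive (subgrp_cyclic (cyclic_gen p k.+1, w)).
    + move=> e [c]; rewrite pairMz => -[/esym c0 ->].
      have : ((p ^ k.+1)%N %| c)%Z.
        apply: (mulrz_tower_eq0 (t := cyclic_gen p k.+1 *+ p ^ k) p_prime _ _ _ c0) => //.
          by rewrite -mulrn_powSr cyclic_exp.
        apply/eqP => /(cyclic_gen_dvd _ p_prime) /dvdn_leq.
        by rewrite expn_gt0 prime_gt0 // leq_exp2l ?prime_gt1 // ltnn => /(_ isT).
      case/dvdzP=> d ->; rewrite mulrC mulrzA -pmulrn mulrn_powSr -tE tp.
      by rewrite mul0rz.
    + exists (w *+ val (a : 'I_(p ^ k.+1).-1.+1)).
      exists (val (a : 'I_(p ^ k.+1).-1.+1))%:Z.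
      by rewrite pairMz -!pmulrn -cyclic_gen_span.
    + exists h; rewrite raddfMn tE; congr (_ *+ _); apply: hE.
      by exists 1; rewrite mulr1z.
exists (prufer_elt p_prime 0); split.
- exact: prufer_elt0.
- exact: prufer_elt_neq0.
- move=> a; have [l [c ->]] := prufer_gen p_prime a.
  apply: (@tower_socle p p_prime _ (prufer_elt p_prime 0)) => //.
  + exact: prufer_elt0.
  + exact: prufer_elt_neq0.
  + by move=> i; right; exact: prufer_eltS.
- move=> A t tp [w [w0 wS]].
  have wt l : w l *+ p ^ l = t by rewrite -w0; elim: l => // l IHl; rewrite mulrn_powS -wS.
  have [||a|h hE] := graph_additive
      (@subgrp_tower p (prufer p * A)%type (fun l => (prufer_elt p_prime l, w l)) _).
  + by move=> l; right; rewrite pairMnE -prufer_eltS -wS.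
  + move=> e [l [c]]; rewrite pairMz => -[/esym c0 ->].
    have /dvdzP[d ->] : ((p ^ l.+1)%N %| c)%Z.
      apply: (mulrz_tower_eq0 p_prime (prufer_elt0 p_prime) _ _ c0).
        exact: prufer_elt_neq0.
      exact: prufer_elt_pow.
    by rewrite mulrC mulrzA -pmulrn mulrn_powSr wt tp mul0rz.
  + have [l [c ->]] := prufer_gen p_prime a; exists (w l *~ c), l, c.
    by rewrite pairMz.
  + exists h; rewrite -w0; apply: hE; exists 0, 1.
    by rewrite mulr1z.
Qed.

Lemma finite_exponent_socle s : finite_set [set a : Z s | a *+ p = 0]%classic.
Proof.
have [s0|] := boolP (exponent_lt (Some 0%N) s).
  have [u [up _ ugen _]] := exponent_socle_gen s0.
  apply: sub_finite_set (@finite_lincomb p p_prime _ (fun=> u) 1 (fun=> up)).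
  move=> a /= /ugen[c ->]; exists (fun=> c) => //.
  by rewrite /lincomb big_ord_recl big_ord0 addr0.
by case: s => [[|k]|] //=.
Qed.

Lemma exponent_pgroup s : abelian_pgroup p (Z s).
Proof.
case: s => [k|] a; apply/asboolP; first by exists k; exact: cyclic_exp.
have /asboolP[k ak] := valP a; exists k; apply: val_inj.
by rewrite raddfMn.
Qed.

End ExponentGroups.

Section DirectSums.
Variables (p n : nat).

Lemma malg_pgroup (P : zmodType) (I : choiceType) :
  abelian_pgroup p P -> abelian_pgroup p {malg P[I]}.
Proof.
move=> pP g; rewrite [g]monalgE; apply: rpred_sum => i _.
have /asboolP[k gk] := pP g@_i; apply/asboolP; exists k.
by rewrite -monalgUMn gk monalgU0.
Qed.

Variable (A : 'I_n -> zmodType).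
Local Notation D := (dirsum A).

Lemma dirsumB (f g : D) j : (f - g) j = f j - g j.
Proof. by rewrite [f - g]/(dirsum_add f (dirsum_opp g)) /dirsum_add /dirsum_opp !ffunE. Qed.

Lemma dirsumD (f g : D) j : (f + g) j = f j + g j.
Proof. by rewrite [f + g]/(dirsum_add f g) ffunE. Qed.

Lemma dirsum0 j : (0 : D) j = 0.
Proof. by rewrite [0 : D]/(dirsum_zero A) ffunE. Qed.

Lemma dirsumMn (f : D) m j : (f *+ m) j = f j *+ m.
Proof.
elim: m => [|m IHm]; first by rewrite !mulr0n dirsum0.
by rewrite !mulrSr dirsumD IHm.
Qed.

Lemma dirsumP (f g : D) : (forall j, f j = g j) -> f = g.
Proof. by move=> fg; apply/ffunP. Qed.

Definition dirsum_inj j (a : A j) : D := [ffun i => dfwith (fun i => 0 : A i) a i].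

Lemma dirsum_injE j (a : A j) : dirsum_inj a j = a.
Proof. by rewrite ffunE dfwith_in. Qed.

Lemma dirsum_inj_neq j (a : A j) i : i != j -> dirsum_inj a i = 0.
Proof. by move=> ij; rewrite ffunE dfwith_out // eq_sym. Qed.

Lemma dirsum_divisible (f : D) m : (forall j, exists a, f j = a *+ m) ->
  exists g, f = g *+ m.
Proof.
move=> fm; have fm' j : {a | f j = a *+ m} by apply: cid.
exists ([ffun j => sval (fm' j)] : D); apply: dirsumP => j.
by rewrite dirsumMn ffunE; case: (fm' j).
Qed.

Lemma dirsum_pgroup : (forall j, abelian_pgroup p (A j)) -> abelian_pgroup p D.
Proof.
move=> pA f; have /choice[k kP] j : exists k, f j *+ p ^ k = 0.
  by have /asboolP := pA j (f j).
apply/asboolP; exists (\max_j k j)%N; apply: dirsumP => j.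
by rewrite dirsumMn dirsum0; apply: mulrn_pow0 (kP j); exact: leq_bigmax.
Qed.

Lemma dirsum_hom (V : zmodType) (h : forall j, {additive A j -> V}) :
  exists H : {additive D -> V}, forall f, H f = \sum_j h j (f j).
Proof.
pose H f := \sum_j h j ((f : D) j).
have HB : zmod_morphism H.
  by move=> f g; rewrite /H -sumrB; apply: eq_bigr => j _; rewrite dirsumB raddfB.
by exists (HB.pack_for {additive D -> V} H (GRing.isZmodMorphism.Build _ _ H HB)).
Qed.

Lemma malg_hom (P V : zmodType) (I : choiceType) (h : I -> {additive P -> V}) :
  exists H : {additive {malg P[I]} -> V},
    (forall g, H g = \sum_(i <- msupp g) h i g@_i) /\ forall i a, H << a *g i >> = h i a.
Proof.
pose H g := \sum_(i <- msupp g) h i (g : {malg P[I]})@_i.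
have HE (d : {fset I}) g : (msupp g `<=` d)%fset -> H g = \sum_(i <- d) h i g@_i.
  move=> gd; rewrite /H (big_fset_incl _ gd) //= => i _ /mcoeff_outdom ->.
  exact: raddf0.
have HB : zmod_morphism H.
  move=> f g; pose d := (msupp f `|` msupp g)%fset.
  rewrite !(HE d) ?fsubsetUl ?fsubsetUr ?msuppB_le // -sumrB.
  by apply: eq_bigr => i _; rewrite mcoeffB raddfB.
exists (HB.pack_for {additive {malg P[I]} -> V} H
  (GRing.isZmodMorphism.Build _ _ H HB)); split=> // i a.
rewrite -[LHS]/(H _) (HE _ _ (msuppU_le (x := a))).
by rewrite big_seq_fset1 mcoeffUU.
Qed.

End DirectSums.

Section PrankNecessary.
Variables (p : nat) (p_prime : prime p).

Lemma finite_malg_socle s (I : choiceType) : finite_set [set: I] ->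
  finite_set [set g : {malg (Zp_exponent p s)[I]} | g *+ p = 0]%classic.
Proof.
move=> /finite_seqP[r rE].
apply: (@finite_by_coords _ _ _ r (fun i (g : {malg (Zp_exponent p s)[I]}) => g@_i)) =>
  [i|x y _ _ xy].
  apply: sub_finite_set (finite_exponent_socle p_prime s) => _ [g gp <-].
  by rewrite /= -mcoeffMn gp mcoeff0.
apply/malgP => i; move/eq_in_map: xy; apply.
by have := congr1 (@^~ i) rE; rewrite /= => <-.
Qed.

Lemma prank_dichotomy_iso (V W : zmodType) (f : {additive V -> W}) :
  bijective f -> prank_dichotomy p W -> prank_dichotomy p V.
Proof.
move=> [g fK gK] dichW m; case: (dichW m) => [soc|fin]; [left|right].
  move=> x xp; have [|y fxE] := soc (f x); first by rewrite -raddfMn xp raddf0.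
  by exists (g y); apply: (can_inj fK); rewrite raddfMn gK.
apply: sub_finite_set (finite_image g fin) => x [xp [y xE]].
exists (f x); last exact: fK.
by split; [rewrite -raddfMn xp raddf0|exists (f y); rewrite -raddfMn -xE].
Qed.

Lemma generalized_finite_prank_dichotomy V :
  generalized_finite_prank p V -> prank_dichotomy p V.
Proof.
move=> [n [sigma [rho [sigma_lt rho_fin [f f_bij]]]]].
apply: prank_dichotomy_iso f_bij _ => m.
pose A i : zmodType := {malg (Zp_exponent p (sigma i))[rho i]}.
have [high|/existsNP[j /negP jm]] := pselect (forall j, exponent_lt (Some m) (sigma j)).
  left=> x xp; apply: (@dirsum_divisible n A) => j; apply: malg_divisible => i.
  apply: exponent_divisible => //.
  have := dirsumMn (A := A) x p j; rewrite xp dirsum0 => /(congr1 (mcoeff i)).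
  by rewrite mcoeff0 mcoeffMn.
right.
(* Exponents increase, so those up to [j] are at most [m]. In particular [p ^ m] kills component
   [0], the only one that may have infinitely many copies. *)
have low (i : 'I_n) : (i <= j)%N -> exists2 k, sigma i = Some k & (k <= m)%N.
  rewrite leq_eqVlt => /orP[/eqP/val_inj -> |/sigma_lt].
    by case: (sigma j) jm => [k|] //= km; exists k; rewrite // leqNgt.
  case: (sigma i) => [k|]; case: (sigma j) jm => [l|] //= lm kl.
  by exists k; rewrite // (leq_trans (ltnW kl)) // leqNgt.
(* Tagging puts coordinates from different groups into one type. *)
apply: (@finite_by_coords _ {i : 'I_n & A i} _ (enum 'I_n)
   (fun i (g : dirsum A) => Tagged A (g i))) => [i|x y _ _ xy]; last first.
  apply: dirsumP => i; move/eq_in_map: xy => /(_ i (mem_enum _ i)).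
  by move/eqP; rewrite eq_Tagged => /eqP.
have [i_gt0|] := ltnP 0 i.
  have fin := finite_malg_socle (sigma i) (rho_fin i i_gt0).
  apply: sub_finite_set (finite_image (Tagged A (i := i)) fin) => _ [g [gp _] <-].
  exists (g i) => //; have := dirsumMn (A := A) g p i.
  by rewrite gp dirsum0 => /esym.
rewrite leqn0 => /eqP i0.
have [|k sk km] := low i; first by rewrite i0.
apply: (@sub_finite_set _ _ [set Tagged A (0 : A i)]%classic); last exact: finite_set1.
move=> _ [g [_ [y ->]] <-] /=; congr Tagged.
rewrite (dirsumMn (A := A)); apply/malgP => l; rewrite mcoeffMn mcoeff0.
apply: (mulrn_pow0 km); move: (y i)@_l; rewrite sk => a.
exact: cyclic_exp.
Qed.

End PrankNecessary.

(** * Decomposition along the heights of the socle *)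

Section Basis.
Variables (p : nat) (p_prime : prime p) (A : zmodType).

(* A basis of the F_p-vector space (V + U) / U. *)
Lemma relative_basis (V U : A -> Prop) : subgrp V -> subgrp U ->
  (forall x, V x -> x *+ p = 0) ->
  exists S : A -> Prop, [/\ forall x, S x -> V x,
    forall (r : seq A) (c : A -> int), uniq r -> (forall z, z \in r -> S z) ->
      U (\sum_(z <- r) z *~ c z) -> forall z, z \in r -> (p %| c z)%Z &
    forall x, V x -> exists (r : seq A) (c : A -> int),
      (forall z, z \in r -> S z) /\ U (x - \sum_(z <- r) z *~ c z)].
Proof.
move=> sV sU Vp.
pose indep (S : set A) := forall (r : seq A) (c : A -> int), uniq r ->
  (forall z, z \in r -> S z) -> U (\sum_(z <- r) z *~ c z) ->
  forall z, z \in r -> (p %| c z)%Z.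
have [] := @Zorn_bigcup A (fun S => (forall x, S x -> V x) /\ indep S).
  move=> F FP Ftot; split=> [x [S /FP[SV _] Sx]|r c ur rS]; first exact: SV.
  have [[S0 FS0]|noF] := pselect (exists S, F S); last first.
    move=> _ z /rS [S FS _]; by case: noF; exists S.
  have [S FS rS'] : exists2 S, F S & forall z, z \in r -> S z.
    elim: r {ur} rS => [|z r IHr] rS; first by exists S0.
    have [|S1 FS1 rS1] := IHr; first by move=> y yr; apply: rS; rewrite inE yr orbT.
    have [S2 FS2 S2z] := rS z (mem_head _ _).
    have [S12|S21] := Ftot _ _ FS1 FS2.
      exists S2 => // y; rewrite inE => /orP[/eqP -> //|/rS1]; exact: S12.
    exists S1 => // y; rewrite inE => /orP[/eqP ->|/rS1 //]; exact: S21.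
  by have [_ iS] := FP _ FS; apply: iS.
move=> S [[SV iS] maxS]; exists S; split=> // x Vx.
have [Sx|nSx] := pselect (S x).
  exists [:: x], (fun=> 1); split=> [z|]; first by rewrite inE => /eqP ->.
  by rewrite big_seq1 mulr1z subrr; case: sU.
apply: contrapT => nx; apply: (maxS (fun y => S y \/ y = x)).
  by split=> [y Sy|/(_ x (or_intror erefl))]; first left.
split=> [y [/SV //|-> //]|r c ur rS Ur].
have xp := Vp x Vx.
have [xr|nxr] := boolP (x \in r); last first.
  apply: iS => // z zr; case: (rS z zr) => // zx.
  by rewrite -zx zr in nxr.
have rS' z : z \in rem x r -> S z.
  rewrite mem_rem_uniq // inE => /andP[/eqP zx zr].
  by case: (rS z zr).
move: Ur; rewrite (perm_big _ (perm_to_rem xr)) big_cons /= => Ur.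
have pcx : (p %| c x)%Z.
  apply: contrapT => pc; have [d xE] := @mulrz_bezout _ p_prime _ x (c x) 1 pc xp.
  apply: nx; exists (rem x r), (fun z => - (c z * d)); split=> //.
  have -> : x - \sum_(z <- rem x r) z *~ - (c z * d) =
      (x *~ c x + \sum_(z <- rem x r) z *~ c z) *~ d.
    rewrite mulrzDl -xE mulrz_suml -sumrN; congr (_ + _); apply: eq_bigr => z _.
    by rewrite mulrNz opprK mulrzA.
  exact: subgrpMz.
rewrite (mulrz_dvd xp pcx) add0r in Ur.
move=> z zr; have [-> //|zx] := eqVneq z x.
by apply: (iS _ _ (rem_uniq x ur) rS' Ur); rewrite mem_rem_uniq // inE zx.
Qed.

End Basis.

Section PrankSufficient.
Variables (p : nat) (p_prime : prime p) (A : zmodType) (pA : abelian_pgroup p A).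

(* Bases of (p^j A)[p] relative to (p^(j+1) A)[p], for k <= j < k + t, and of
   (p^(k+t) A)[p] are extended to cyclic and quasi-cyclic subgroups; their sum is A
   since the socles agree, including heights. *)
Lemma filtration_finite_prank k t :
  (forall x : A, x *+ p = 0 -> exists y, x = y *+ p ^ k) ->
  (0 < t -> finite_set (@psoc p A k.+1))%N ->
  divisible_from p A (k + t) -> generalized_finite_prank p A.
Proof.
move=> soc_k fin_k div_t.
(* A cyclic group of order [p ^ (k + j).+1] has its socle at height [k + j]; the top level, of
   infinite height, carries Prüfer groups. A height that does not occur gives an empty [rho j]. *)
pose sigma (j : 'I_t.+1) : exponent := if (j < t)%N then Some (k + j).+1 else None.
pose U (j : 'I_t.+1) (x : A) := if (j < t)%N then psoc p (k + j).+1 x else x = 0.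
have s0 := subgrp0 A.
have sU j : subgrp (U j).
  by rewrite /U; case: (j < t)%N => //; exact: subgrp_psoc.
have /choice[S SP] (j : 'I_t.+1) := relative_basis p_prime (@subgrp_psoc p A (k + j)) (sU j)
  (fun x => @proj1 _ _).
pose rho (j : 'I_t.+1) : choiceType := {x : A | `[< S j x >]}.
have rhoV j (i : rho j) : psoc p (k + j) (val i).
  by have [SV _ _] := SP j; apply: SV; apply/asboolP; exact: (valP i).
have sigma_pos j : exponent_lt (Some 0%N) (sigma j) by rewrite /sigma; case: ifP.
pose uP j := cid (exponent_socle_gen p_prime (sigma_pos j)).
pose u j := sval (uP j).
have u_order j : u j *+ p = 0 by have [up0 _ _ _] := svalP (uP j); exact: up0.
have u_hom j (i : rho j) : exists h : {additive Zp_exponent p (sigma j) -> A}, h (u j) = val i.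
  have [_ _ _] := svalP (uP j); apply; first by case: (rhoV j i).
  have [_ [y yE]] := rhoV j i; rewrite /sigma; case: ifPn => jt; first by exists y.
  have [v [v0 vS]] := divisible_tower y div_t; exists v; split=> //.
  rewrite v0 yE; congr (_ *+ p ^ (k + _)); apply/eqP.
  by rewrite eqn_leq leqNgt jt -ltnS ltn_ord.
pose h j (i : rho j) := sval (cid (u_hom j i)).
have hE j i : h j i (u j) = val i by exact: svalP (cid (u_hom j i)).
have [H HP] : exists H : forall j, {additive {malg (Zp_exponent p (sigma j))[rho j]} -> A},
    forall j, (forall g, H j g = \sum_(i <- msupp g) h j i g@_i) /\
      forall i a, H j << a *g i >> = h j i a.
  by exists (fun j => sval (cid (malg_hom (@h j)))) => j; case: cid.
pose M j : zmodType := {malg (Zp_exponent p (sigma j))[rho j]}.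
pose D := dirsum M.
have [Psi PsiE] : exists Psi : {additive D -> A}, forall f : D, Psi f = \sum_j H j (f j).
  exact: dirsum_hom.
have H_socle j g : g *+ p = 0 -> exists c : rho j -> int,
    (forall i, g@_i = u j *~ c i) /\ H j g = \sum_(i <- msupp g) val i *~ c i.
  move=> gp; have /choice[c cE] i : exists c : int, g@_i = u j *~ c.
    have [_ _ + _] := svalP (uP j); apply.
    by rewrite -mcoeffMn gp mcoeff0.
  exists c; split=> //; rewrite (HP j).1; apply: eq_bigr => i _.
  by rewrite cE raddfMz hE.
have H_psoc (j : 'I_t.+1) (g : M j) : g *+ p = 0 -> psoc p (k + j) (H j g).
  move=> /H_socle[c [_ ->]]; apply: subgrp_sum; first exact: subgrp_psoc.
  by move=> i; apply: subgrpMz; [exact: subgrp_psoc|exact: rhoV].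
have H_inj (j : 'I_t.+1) (g : M j) : g *+ p = 0 -> U j (H j g) -> g = 0.
  move=> /H_socle[c [cE ->]] Uc; apply/malgP => i; rewrite mcoeff0.
  case: msuppP => // ig; rewrite cE; apply: mulrz_dvd.
    exact: u_order.
  pose c' (x : A) : int := if insub x is Some i' then c i' else 0.
  have c'E i' : c' (val i') = c i' by rewrite /c' valK.
  have [_ ind _] := SP j; rewrite -c'E.
  apply: (ind [seq val i' | i' <- enum_fset (msupp g)]).
  - by rewrite map_inj_uniq ?fset_uniq //; exact: val_inj.
  - by move=> _ /mapP[i' _ ->]; apply/asboolP; exact: (valP i').
  - by rewrite big_map; under eq_bigr do rewrite c'E.
  - exact: map_f.
have pD : abelian_pgroup p D.
  by apply: dirsum_pgroup => j; apply: malg_pgroup; exact: exponent_pgroup.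
have U_gt (i j : 'I_t.+1) x : (j < i)%N -> psoc p (k + i) x -> U j x.
  move=> ji; rewrite /U (leq_trans ji) ?leq_ord //.
  by apply: psoc_le; rewrite ltn_add2l.
have Psi_inj : injective Psi.
  apply: raddf_inj => f Psif.
  have sL : subgrp (fun f => Psi f = 0).
    by split=> [|x y x0 y0]; rewrite ?raddf0 // raddfB x0 y0 subrr.
  apply: (socle_trivial pD sL) Psif => {}f Psif fp.
  have fjp j : f j *+ p = 0 by rewrite -(dirsumMn f) fp dirsum0.
  apply: dirsumP => j; rewrite dirsum0.
  (* From the lowest coordinate upwards: earlier ones vanish, later ones map into [U j], modulo
     which the basis of level [j] is independent. *)
  have [m] := ubnP (nat_of_ord j); elim: m j => // m IHm j jm.
  apply: H_inj => //; move: Psif; rewrite PsiE (bigD1 j) //= => /eqP.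
  rewrite addr_eq0 => /eqP ->; apply: subgrpN => //.
  rewrite big_mkcond; apply: subgrp_sum => // i.
  case: eqVneq => [_|ij]; first by case: (sU j).
  have [ij'|ji|/val_inj ij'] := ltngtP i j; last by rewrite ij' eqxx in ij.
    rewrite IHm ?raddf0; first by case: (sU j).
    exact: leq_trans ij' _.
  exact: U_gt ji (H_psoc _ _ (fjp i)).
have Psi_inj_at j (g : M j) : Psi (dirsum_inj g) = H j g.
  rewrite PsiE (bigD1 j) //= dirsum_injE big1 ?addr0 // => i ij.
  by rewrite dirsum_inj_neq // raddf0.
(* [K s] records heights inside the image of [Psi], as [socle_pure_full] needs them for
   surjectivity. *)
pose K s x := exists f, x = Psi f *+ p ^ s.
have sK s : subgrp (K s).
  split; first by exists 0; rewrite raddf0 mul0rn.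
  by move=> _ _ [f ->] [g ->]; exists (f - g); rewrite raddfB mulrnBl.
have K_split (j : 'I_t.+1) x s : psoc p (k + j) x -> (s <= k + j)%N \/ j = t :> nat ->
    (forall y, U j y -> K s y) -> K s x.
  move=> xj sj UK; have [_ _ /(_ x xj)[r [c [rS Ux]]]] := SP j.
  rewrite -(subrK (\sum_(z <- r) z *~ c z) x); apply: (subgrpD (sK s)); first exact: UK.
  rewrite big_seq; apply: (big_ind (K s)) => [|y z Ky Kz|z /rS Sz].
  - by case: (sK s).
  - exact: subgrpD.
  - apply: subgrpMz => //.
    have [|b bE] := @exponent_divisible p p_prime (sigma j) s (u j) _ (u_order j).
      rewrite /sigma; case: ifP => //= jt; rewrite ltnS.
      by case: sj => // jt0; rewrite jt0 ltnn in jt.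
    have Sz' : `[< S j z >] by exact/asboolP.
    pose i : rho j := exist _ z Sz'.
    exists (dirsum_inj (<< b *g i >> : M j)).
    by rewrite Psi_inj_at (HP j).2 -raddfMn -bE hE.
(* Downward induction on the level: a combination of the basis of level [j] leaves a remainder in
   the next level, or zero at the top, where divisibility of Prüfer groups gives every [s]. *)
have Psi_onto d (j : 'I_t.+1) : (j + d = t)%N -> forall x, psoc p (k + j) x ->
    forall s, (s <= k + j)%N \/ j = t :> nat -> K s x.
  elim: d j => [|d IHd] j jd x xj s sj.
    have jt : (j < t)%N = false by rewrite -[X in (_ < X)%N]jd addn0 ltnn.
    apply: (K_split j x s) => // y; rewrite /U jt => ->.
    by case: (sK s).
  have jt : (j < t)%N by rewrite -[X in (_ < X)%N]jd addnS ltnS leq_addr.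
  apply: (K_split j x s) => // y; rewrite /U jt => yj.
  have jt' : (j.+1 < t.+1)%N by [].
  apply: (IHd (Ordinal jt')); rewrite /= ?addnS //; first by rewrite addSn -addnS.
  case: sj => [sj|jt0]; first by left; exact: leqW.
  by move: jt; rewrite jt0 ltnn.
have Psi_psoc s x : psoc p s x -> K s x.
  move=> xs; have [sk|ks] := leqP s k.
    apply: (Psi_onto t ord0); rewrite // addn0; last by left.
    by split; [case: xs|apply: soc_k; case: xs].
  have [st|ts] := leqP s (k + t).
    have jt : (s - k < t.+1)%N by rewrite ltnS leq_subLR.
    apply: (Psi_onto (t - (s - k))%N (Ordinal jt)); rewrite /= ?subnKC ?(ltnW ks) //.
    by left.
  apply: (Psi_onto 0%N ord_max); rewrite /= ?addn0 //; last by right.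
  by apply: psoc_le xs; exact: ltnW.
have Psi_surj x : exists f, x = Psi f.
  have sI : subgrp (fun y => exists f, y = Psi f).
    exact: (sK 0%N).
  apply: (socle_pure_full pA sI) => [y j _ /Psi_psoc[f ->]|y yp].
    by exists (Psi f) => //; exists f.
  have [|f ->] := Psi_psoc 0%N y; first by split=> //; exists y.
  by exists f.
exists t.+1, sigma, rho; split.
- move=> i j ij; rewrite /sigma (leq_trans ij) ?leq_ord //.
  by case: ifP => //= _; rewrite ltnS ltn_add2l.
- move=> j j_gt0.
  have /fin_k fin : (0 < t)%N by exact: leq_trans j_gt0 (leq_ord j).
  apply: (@sub_finite_set _ _ ((val : rho j -> A) @^-1` @psoc p A k.+1)%classic).
    by move=> i _ /=; apply: psoc_le (rhoV j i); rewrite -addn1 leq_add2l.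
  by apply: finite_preimage => // a b _ _; exact: val_inj.
- have /choice[g gP] := Psi_surj.
  have gB : zmod_morphism g by move=> x y; apply: Psi_inj; rewrite raddfB -!gP.
  exists (HB.pack_for {additive A -> D} g (GRing.isZmodMorphism.Build _ _ g gB)).
  by exists Psi => [x|f]; [rewrite /= -gP|apply: Psi_inj; rewrite /= -gP].
Qed.

Lemma prank_dichotomy_finite_prank : prank_dichotomy p A -> generalized_finite_prank p A.
Proof.
move=> dichA.
have [allsoc|/existsNP[m0 nsoc]] :=
  pselect (forall m (x : A), x *+ p = 0 -> exists y, x = y *+ p ^ m).
  apply: (@filtration_finite_prank 0 0) => //; first exact: allsoc.
  by apply: divisible_from_psoc => // x j [xp _]; exact: allsoc.
(* If [p ^ k.+1] is the least power that fails to divide the socle, the dichotomy makes the socle of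
   [p ^ k.+1 A] finite, so only level [k] can have infinitely many summands. *)
pose bad m := `[< ~ forall x : A, x *+ p = 0 -> exists y, x = y *+ p ^ m >].
have ex : exists m, bad m by exists m0; apply/asboolP.
case: (ex_minnP ex) => -[|k] /asboolP badk mink.
  by case: badk => x _; exists x.
have fin : finite_set (@psoc p A k.+1) by case: (dichA k.+1).
have [N [kN divN]] := finite_psoc_divisible_from pA fin.
apply: (@filtration_finite_prank k (N - k)) => // [x xp|]; last first.
  by rewrite subnKC // ltnW.
apply: contrapT => nx; have /mink : bad k by apply/asboolP => /(_ x xp).
by rewrite ltnn.
Qed.

End PrankSufficient.

Theorem theorem2p7 (p : nat) (G : zmodType) (p_prime : prime p)
    (G_pgroup : abelian_pgroup p G) :
  (semi_generalized_co_Bassian G <-> generalized_co_Bassian (multiples G p)) /\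
  (generalized_co_Bassian (multiples G p) <->
   generalized_finite_prank p (multiples G p)).
Proof.
have pgG := multiples_pgroup G_pgroup.
have coB : generalized_co_Bassian (multiples G p) <-> prank_dichotomy p (multiples G p).
  split; first exact: co_Bassian_prank_dichotomy.
  exact: prank_dichotomy_co_Bassian.
split; rewrite coB.
  rewrite -multiples_dichotomyP; split; first exact: semi_multiples_dichotomy.
  exact: multiples_dichotomy_semi.
split; first exact: prank_dichotomy_finite_prank.
exact: generalized_finite_prank_dichotomy.
Qed.
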